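(* The following hold: (i) $\Delta(\varepsilon)=2\varepsilon-1$ for $\tfrac{11}{16}\le\varepsilon\le1$, and $\Delta(\varepsilon)\ge 2\varepsilon-1$ for $\tfrac12\le\varepsilon\le\tfrac{11}{16}$; (ii) $\Delta(\varepsilon)\ge 0.591389\,\varepsilon^2$ for all $0<\varepsilon\le1$; (iii) $\Delta(\varepsilon)\ge 0.5546\,\varepsilon^2+0.088079\,\varepsilon^3$ for all $0<\varepsilon\le1$; (iv) $\Delta(\varepsilon)\le \tfrac{96}{121}\varepsilon^2<0.79339\,\varepsilon^2$ for $0<\varepsilon\le\tfrac{11}{16}$; (v) $\Delta(\varepsilon)\le \dfrac{\pi\varepsilon^2}{(1+\sqrt{1-\varepsilon})^2}=\tfrac{\pi}{4}\varepsilon^2+O(\varepsilon^3)$ for all $0<\varepsilon\le1$.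
   Context: Let $\lambda$ denote Lebesgue measure on $\mathbb{R}$. A set $C\subseteq\mathbb{R}$ is symmetric if there is a number $c$ such that $c+x\in C$ if and only if $c-x\in C$. For a measurable $A\subseteq\mathbb{R}$ let $D(A):=\sup\{\lambda(C): C\subseteq A,\ C \text{ measurable and symmetric}\}$. For $0\le\varepsilon\le1$ let $\Delta(\varepsilon):=\inf\{D(A): A\subseteq[0,1) \text{ measurable},\ \lambda(A)=\varepsilon\}$. *)

(* Defs.v *)
From mathcomp Require Import all_boot all_order all_algebra.
From mathcomp Require Import all_classical all_reals all_analysis.
Set Implicit Arguments. Unset Strict Implicit. Unset Printing Implicit Defensive.
Import Order.TTheory GRing.Theory Num.Theory.
Local Open Scope classical_set_scope.
Local Open Scope ring_scope.

(* The Lebesgue sigma-algebra on R (Caratheodory-measurable sets for the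
   Lebesgue outer measure) and (completed) Lebesgue measure on it. *)
Definition LebT (R : realType) : Type :=
  caratheodory_type (R:=R) (wlength (@idfun R))^*%mu.

Definition lambda {R : realType} (A : set R) : \bar R :=
  @completed_lebesgue_measure R A.

Definition Lmeasurable {R : realType} (A : set R) : Prop :=
  measurable (A : set (LebT R)).

Definition symmetric_set {R : realType} (C : set R) : Prop :=
  exists c : R, forall x : R, C (c + x) <-> C (c - x).

Definition Dsym {R : realType} (A : set R) : \bar R :=
  ereal_sup [set lambda C | C in
    [set C : set R | Lmeasurable C /\ C `<=` A /\ symmetric_set C]].

Definition Delta {R : realType} (eps : R) : \bar R :=
  ereal_inf [set Dsym A | A in
    [set A : set R | Lmeasurable A /\ A `<=` `[0, 1[%classic
                     /\ lambda A = eps%:E]].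

(* Main.v *)
Require Import Defs.
From mathcomp Require Import all_boot all_order all_algebra.
From mathcomp Require Import all_classical all_reals all_analysis.
From mathcomp Require Import zify ring lra.
Import Order.TTheory GRing.Theory Num.Theory.
Local Open Scope classical_set_scope.
Local Open Scope ring_scope.
Set Implicit Arguments. Unset Strict Implicit. Unset Printing Implicit Defensive.

(* [Dsym A] is the supremum over [c] of the measure of [A] intersected with its reflection
   [c - A], i.e. the supremum of the autoconvolution of the indicator of [A]. Everything
   is reduced to the case where [A] is a union of cells of a regular grid, described by a
   set [E] of integers, for which that supremum is the largest number [reps E k] of ordered
   representations [k = i + j].

   Upper bounds. A step function [a] with values in [0, 1] and autoconvolution at most [M]
   can be thinned to a set of integers with the same densities and almost the same
   autoconvolution: on the [i]-th step keep a fixed proportion of the residues modulo a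
   prime [p i], with distinct primes for distinct steps. The densities
   [t * (1, 0, 1/2, 1, 0, 1, 1, 1)] give (i) and (iv), and [min (1, b / sqrt x)] with
   [b = 1 - sqrt (1 - eps)] gives (v).

   Lower bounds. [A] and [1 - A] overlap in measure at least [2 eps - 1]. Moreover
   [Delta eps >= 0.6095 eps^2], which implies (ii) and, for [eps <= 0.618], also (iii). Let
   [q] and [r] be the autocorrelation and autoconvolution of [f = 1_E], and [H] the
   autocorrelation of a window. Smoothing the symmetrisation of [f] by the window and
   applying Cauchy-Schwarz bounds [sum (q + r) H] from below, while [sum q H] is bounded
   above by its mean-value part plus a variance term controlled by
   [sum q^2 = sum r^2 <= max r * (sum f)^2]. *)

(** * Lebesgue outer measure, reflections and unions of cells *)

Section lambda_facts.
Variable R : realType.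
Implicit Types (A B C : set R) (c M : R).

Lemma lambdaE A : lambda A = ((wlength (@idfun R))^*)%mu A.
Proof. by []. Qed.

Lemma lambda_lebesgue A : lambda A = lebesgue_measure A.
Proof. by []. Qed.

Lemma le_lambda A B : A `<=` B -> (lambda A <= lambda B)%E.
Proof. exact: (le_mu_ext (wlength (@idfun R))). Qed.

Lemma lambda_ge0 A : (0 <= lambda A)%E.
Proof. exact: (outer_measure_ge0 ((wlength (@idfun R))^*)%mu). Qed.

Lemma lambda0 : lambda (set0 : set R) = 0%E.
Proof. exact: (outer_measure0 ((wlength (@idfun R))^*)%mu). Qed.

Lemma lambdaU A B : (lambda (A `|` B) <= lambda A + lambda B)%E.
Proof. exact: (outer_measureU2 ((wlength (@idfun R))^*)%mu). Qed.

Lemma borel_Lmeasurable A : measurable A -> Lmeasurable A.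
Proof. exact: sub_caratheodory. Qed.

Lemma lambda_split A B : Lmeasurable A ->
  lambda B = (lambda (B `&` A) + lambda (B `\` A))%E.
Proof. by move=> mA; exact: mA. Qed.

Lemma Lmeasurable_le A : (forall X, (lambda (X `&` A) + lambda (X `&` ~` A) <= lambda X)%E)
  -> Lmeasurable A.
Proof. by move=> H; apply: le_caratheodory_measurable. Qed.

Lemma lambda_itv (a b : R) (x y : bool) : a <= b ->
  lambda [set` Interval (BSide x a) (BSide y b)] = (b - a)%:E.
Proof.
rewrite lambda_lebesgue lebesgue_measure_itv /= lte_fin le_eqVlt.
case/predU1P => [->|-> //]; by rewrite ltxx subrr.
Qed.

Definition refl c A : set R := [set x | A (c - x)].

Lemma reflK c A : refl c (refl c A) = A.
Proof.
by apply/seteqP; split => x; rewrite /refl /= opprB addrCA subrr addr0.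
Qed.

(** A cover of [A] by half-open intervals reflects to a cover of [refl c A]. The reflected intervals
    are half-open at the other end, so the bound goes through countable subadditivity and their
    lengths. *)
Lemma lambda_refl_le c A : (lambda (refl c A) <= lambda A)%E.
Proof.
rewrite [X in (_ <= X)%E]lambdaE; apply: le_ereal_inf_tmp => _ [B [mB AB] <-].
apply: (@le_trans _ _ (lambda (\bigcup_k refl c (B k)))).
  by apply: le_lambda => x /= /AB [k _ ?]; exists k.
apply: (le_trans (outer_measure_sigma_subadditive _ _)).
apply: lee_nneseries => [k _ _|k _]; first exact: outer_measure_ge0.
case: (mB k) => -[a b] _ <-.
have [ab|ba] := leP b a.
  rewrite set_itv_ge ?bnd_simp -?leNgt//.
  rewrite (_ : refl c set0 = set0); last by apply/seteqP; split.
  rewrite outer_measure0; exact: wlength_ge0.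
rewrite (_ : refl c _ = `[c - b, c - a[%classic); last first.
  apply/seteqP; split => x; rewrite /refl /= !in_itv /= => /andP[? ?];
    by apply/andP; split; lra.
rewrite [X in (X <= _)%E]lambda_itv; last lra.
rewrite wlength_itv /= lte_fin ba -EFinB lee_fin; lra.
Qed.

Lemma lambda_refl c A : lambda (refl c A) = lambda A.
Proof.
apply/eqP; rewrite eq_le lambda_refl_le /=.
by rewrite -{1}(reflK c A) lambda_refl_le.
Qed.

Lemma Lmeasurable_refl c A : Lmeasurable A -> Lmeasurable (refl c A).
Proof.
move=> mA; apply: Lmeasurable_le => X.
rewrite -(lambda_refl c X) (lambda_split (refl c X) mA) -(lambda_refl c (X `&` _)).
rewrite -(lambda_refl c (X `&` ~` _)).
rewrite (_ : refl c (X `&` refl c A) = refl c X `&` A); last first.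
  by rewrite -{2}(reflK c A).
rewrite (_ : refl c (X `&` ~` refl c A) = refl c X `\` A) //.
by rewrite -{2}(reflK c A).
Qed.

(** The intersection is symmetric about [c / 2]. *)
Lemma lambda_refl_Dsym c A : Lmeasurable A ->
  (lambda (A `&` refl c A) <= Dsym A)%E.
Proof.
move=> mA; apply: ereal_sup_ubound; exists (A `&` refl c A) => //.
split; first by apply: measurableI => //; exact: Lmeasurable_refl.
split; first by move=> x [].
exists (c / 2) => x; rewrite /refl /=.
have -> : c - (c / 2 + x) = c / 2 - x by lra.
have -> : c - (c / 2 - x) = c / 2 + x by lra.
by split => -[].
Qed.

(** A symmetric subset of [A] with centre [c] lies both in [A] and in its reflection
    [refl (c + c) A]. *)
Lemma Dsym_le A M : (forall c, (lambda (A `&` refl c A) <= M%:E)%E) ->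
  (Dsym A <= M%:E)%E.
Proof.
move=> H; apply: ge_ereal_sup => _ [C [_ [CA [c Cc]]] <-].
apply: le_trans (H (c + c)); apply: le_lambda => x Cx; split; first exact: CA.
apply: CA; have -> : c + c - x = c - (x - c) by lra.
by apply: (proj1 (Cc (x - c))); rewrite addrC subrK.
Qed.

Lemma lambda_bigcup_le n (X : nat -> set R) (l : nat -> R) :
  (forall i, (i < n)%N -> (lambda (X i) <= (l i)%:E)%E) ->
  (lambda (\bigcup_(i in [set k | (k < n)%N]) X i) <= (\sum_(i < n) l i)%:E)%E.
Proof.
elim: n => [|n IH] H.
  rewrite big_ord0 (_ : \bigcup_(_ in _) _ = set0) ?lambda0 //.
  by apply/seteqP; split => x // [k].
rewrite big_ord_recr /= EFinD.
apply: (@le_trans _ _ (lambda (\bigcup_(i in [set k | (k < n)%N]) X i `|` X n))).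
  apply: le_lambda => x [k /= + Xk]; rewrite ltnS leq_eqVlt => /orP[/eqP kn|kn].
    by right; rewrite -kn.
  by left; exists k.
apply: (le_trans (lambdaU _ _)); apply: leeD; last exact: H.
by apply: IH => i ni; apply: H; exact: leqW.
Qed.

(** Cell [i] of the grid of mesh [1 / Q] is filled from the left in proportion [th i]; a set [E] of
    integers enters through its indicator. With open intervals a reflection [x -> m / Q - x] carries
    full cells exactly onto full cells. *)
Definition cells (Q : nat) (th : nat -> R) (n : nat) : set R :=
  \bigcup_(i in [set k | (k < n)%N])
    `] i%:R / Q%:R, (i%:R + th i) / Q%:R [%classic.

Lemma measurable_cells Q th n : measurable (cells Q th n).
Proof. by apply: bigcup_measurable => i _; exact: measurable_itv. Qed.

Lemma cells_sub Q th n : (0 < Q)%N -> (forall i, th i <= 1) -> 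
  cells Q th n `<=` [set x | x < n%:R / Q%:R].
Proof.
move=> Q0 th1 x [i /= ni]; rewrite in_itv /= => /andP[_ xi].
apply: (lt_le_trans xi); rewrite ler_pM2r ?invr_gt0 ?ltr0n//.
have := th1 i; have : i.+1%:R <= n%:R :> R by rewrite ler_nat.
rewrite -natr1; lra.
Qed.

Lemma lambda_cells Q th n : (0 < Q)%N -> (forall i, 0 <= th i <= 1) ->
  lambda (cells Q th n) = ((\sum_(i < n) th i) / Q%:R)%:E.
Proof.
move=> Q0 th1; have Q0' : 0 < (Q%:R)^-1 :> R by rewrite invr_gt0 ltr0n.
elim: n => [|n IH].
  rewrite big_ord0 mul0r (_ : cells _ _ _ = set0) ?lambda0 //.
  by apply/seteqP; split => x // [k].
have E : cells Q th n.+1 = cells Q th n `|` 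
    `] n%:R / Q%:R, (n%:R + th n) / Q%:R [%classic.
  apply/seteqP; split => x.
    case=> k /= + Xk; rewrite ltnS leq_eqVlt => /orP[/eqP kn|kn].
      by right; rewrite -kn.
    by left; exists k.
  case=> [[k /= kn Xk]|Xn]; first by exists k => //=; exact: leqW.
  by exists n => /=.
have D : cells Q th n `&` `] n%:R / Q%:R, (n%:R + th n) / Q%:R [%classic = set0.
  apply/seteqP; split => x // -[/cells_sub]; rewrite /= in_itv /=.
  move=> /(_ Q0) H1 /andP[H2 _].
  have := H1 (fun i => proj2 (andP (th1 i))); lra.
rewrite E (lambda_split (_ `|` _) (borel_Lmeasurable (@measurable_cells Q th n))).
rewrite setUK setDUl setDv set0U.
rewrite (_ : `] _, _ [%classic `\` _ = `] n%:R / Q%:R, (n%:R + th n) / Q%:R [%classic).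
  rewrite [X in (_ + X)%E]lambda_itv; last first.
    by rewrite ler_pM2r// lerDl; case/andP: (th1 n).
  rewrite IH -EFinD big_ord_recr /=; congr EFin; field.
  by rewrite pnatr_eq0 -lt0n.
apply/seteqP; split => x; first by case.
move=> H; split => // H2; have : set0 x by rewrite -D.
by [].
Qed.

Lemma Delta_le A eps M : Lmeasurable A -> A `<=` `[0, 1[%classic ->
  lambda A = eps%:E -> (forall c, (lambda (A `&` refl c A) <= M%:E)%E) ->
  (Delta eps <= M%:E)%E.
Proof.
move=> mA A01 lA H; apply: le_trans (Dsym_le H).
by apply: ereal_inf_lbound; exists A.
Qed.

Lemma Delta_ge eps M : (forall A, Lmeasurable A -> A `<=` `[0, 1[%classic ->
  lambda A = eps%:E -> (M%:E <= Dsym A)%E) -> (M%:E <= Delta eps)%E.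
Proof. by move=> H; apply: le_ereal_inf_tmp => _ [A [mA [A01 lA]] <-]; exact: H. Qed.

End lambda_facts.

Definition reps (E : pred nat) (k : nat) : nat :=
  (\sum_(i < k.+1) (E i && E (k - i)))%N.

(** * Overlap of a union of cells with its reflections *)

Section cell_sets.
Variable R : realType.
Implicit Types (E : pred nat) (Q : nat) (c M : R).

Lemma mem_cells Q (th : nat -> R) n x : (0 < Q)%N -> cells Q th n x ->
  exists2 i, (i < n)%N & (i%:R < Q%:R * x < i%:R + th i).
Proof.
move=> Q0 [i /= ni]; rewrite in_itv /= => /andP[xi ix]; exists i => //.
have Q0' : 0 < Q%:R :> R by rewrite ltr0n.
by rewrite mulrC -ltr_pdivrMr// xi -ltr_pdivlMr.
Qed.

(** Let [k] and [th] be the integer and fractional parts of [Q * c]. After reflection, cells [i] and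
    [k - i] overlap in length [th / Q], cells [i] and [k - 1 - i] in length [(1 - th) / Q]. The
    total is at most a convex combination of two values of [reps E], divided by [Q]. *)
Lemma lambda_cells_refl_le Q E c M : (0 < Q)%N ->
  (forall k, (reps E k)%:R <= Q%:R * M) ->
  (lambda (cells Q (fun i => (E i)%:R) Q
           `&` refl c (cells Q (fun i => (E i)%:R) Q)) <= M%:E)%E.
Proof.
move=> Q0 HM; have Q0' : 0 < Q%:R :> R by rewrite ltr0n.
have M0 : 0 <= M.
  by rewrite -(pmulr_rge0 _ Q0'); apply: le_trans (HM 0%N).
have mem (x : R) : cells Q (fun i => (E i)%:R) Q x ->
    exists2 i, E i & i%:R < Q%:R * x < i%:R + 1.
  move=> /(mem_cells Q0)[i _]; case Ei : (E i); first by exists i.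
  by rewrite /=; lra.
have [u0|u0] := ltP (Q%:R * c) 0.
  rewrite (_ : _ `&` _ = set0) ?lambda0 ?lee_fin //.
  apply/seteqP; split => // x [/mem[i _ xi] /mem[j _ xj]].
  have : 0 <= i%:R :> R by []. have : 0 <= j%:R :> R by []. by lra.
set u := Q%:R * c in u0.
have [k /andP[ku uk]] : exists k : nat, k%:R <= u < k.+1%:R.
  by exists (Num.trunc u); exact: truncn_itv.
pose th := u - k%:R.
have th0 : 0 <= th by rewrite /th; lra.
have th1 : th <= 1 by move: uk; rewrite /th -natr1; lra.
pose X i := (if E i && E (k - i)%N then `[i%:R / Q%:R, (i%:R + th) / Q%:R]%classic
             else set0) `|`
  (if [&& (i < k)%N, E i & E (k.-1 - i)%N] then
     `[(i%:R + th) / Q%:R, (i%:R + 1) / Q%:R]%classic else set0) : set R.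
pose l i := ((E i && E (k - i)%N)%:R * th +
  [&& (i < k)%N, E i & E (k.-1 - i)%N]%:R * (1 - th)) / Q%:R.
apply: (@le_trans _ _ (lambda (\bigcup_(i in [set j | (j < k.+1)%N]) X i))).
  apply: le_lambda => x [/mem[i Ei xi] /mem[j Ej xj]].
  have xj' : j%:R < u - Q%:R * x < j%:R + 1 by rewrite -mulrBr.
  have ijk : (i + j < k.+1)%N by rewrite -(ltr_nat R) natrD -natr1; move: uk; rewrite -natr1; lra.
  have kij : (k < i + j + 2)%N by rewrite -(ltr_nat R) !natrD; lra.
  have [kE|kE] : k = (i + j)%N \/ k = (i + j).+1.
    by clear -ijk kij; lia.
    exists i => /=; first by clear -ijk; lia.
    left; have -> : (k - i)%N = j by clear -kE; lia.
    rewrite Ei Ej /= in_itv /= ler_pdivrMr// ler_pdivlMr// mulrC /th kE natrD; lra.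
  exists i => /=; first by clear -ijk; lia.
  right; have -> : (k.-1 - i)%N = j by clear -kE; lia.
  have -> : (i < k)%N by clear -kE; lia.
  rewrite Ei Ej /= in_itv /= ler_pdivrMr// ler_pdivlMr// mulrC /th kE -natr1 natrD; lra.
apply: (@le_trans _ _ (\sum_(i < k.+1) l i)%:E).
  apply: lambda_bigcup_le => i _; apply: (le_trans (lambdaU _ _)).
  rewrite [l i]mulrDl EFinD; apply: leeD.
    case: ifP => _; last by rewrite lambda0 !mul0r.
    rewrite [X in (X <= _)%E]lambda_itv; last by rewrite ler_pM2r ?invr_gt0//; lra.
    by rewrite lee_fin mul1r; lra.
  case: ifP => _; last by rewrite lambda0 !mul0r.
  rewrite [X in (X <= _)%E]lambda_itv; last by rewrite ler_pM2r ?invr_gt0//; lra.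
  by rewrite lee_fin mul1r; lra.
rewrite lee_fin -mulr_suml ler_pdivrMr// big_split /= -!mulr_suml.
have -> : \sum_(i < k.+1) (E i && E (k - i)%N)%:R = (reps E k)%:R :> R.
  by rewrite /reps natr_sum.
have H2 : \sum_(i < k.+1) [&& (i < k)%N, E i & E (k.-1 - i)%N]%:R <= Q%:R * M.
  rewrite big_ord_recr /= ltnn /= addr0.
  apply: le_trans (HM k.-1); rewrite /reps natr_sum.
  case: (k) => [|k'] /=; first by rewrite big_ord0 sumr_ge0.
  by apply: ler_sum => i _; rewrite ltn_ord.
have := HM k; move: H2; set a := \sum_(_ < _) _; set b := (reps _ _)%:R => Ha Hb.
by nra.
Qed.

(* The missing measure [y - |E| / Q] is spread evenly over the cells outside [E]; adding
   a set of measure [g] raises the overlap with a reflection by at most [2 g]. *)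
Lemma Delta_cells Q E M (y : R) : (0 < Q)%N -> (forall i, E i -> (i < Q)%N) ->
  (forall k, (reps E k)%:R <= Q%:R * M) ->
  (\sum_(i < Q) (E i)%:R) / Q%:R <= y <= 1 ->
  (Delta y <= (M + 2 * (y - (\sum_(i < Q) (E i)%:R) / Q%:R))%:E)%E.
Proof.
move=> Q0 EQ HM; have Q0' : 0 < Q%:R :> R by rewrite ltr0n.
set S := \sum_(_ < _) _ => /andP[Sy y1].
have SQ : S <= Q%:R.
  rewrite -[leRHS]mulr1 mulrC mulr_natr.
  rewrite -[in leRHS](card_ord Q) -sumr_const.
  by apply: ler_sum => i _; case: (E i).
have Sy' : S <= y * Q%:R by rewrite -ler_pdivrMr.
(* Density given to each cell outside [E]; if [E] fills the grid there is no such cell and 0 is a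
   default. *)
pose t := if S == Q%:R then 0 else (y * Q%:R - S) / (Q%:R - S).
have t01 : 0 <= t <= 1.
  rewrite /t; case: ifPn => [_|SQ']; first by rewrite lexx ler01.
  have SQ2 : 0 < Q%:R - S by rewrite subr_gt0 lt_neqAle SQ' SQ.
  rewrite divr_ge0 /= ?subr_ge0 // ?(ltW SQ2)//.
  by rewrite ler_pdivrMr// mul1r; nra.
have tE : (Q%:R - S) * t = y * Q%:R - S.
  rewrite /t; case: eqP => [SQ'|/eqP SQ'].
    by rewrite SQ' in Sy' *; nra.
  by rewrite mulrC divfK // subr_eq0 eq_sym.
pose g i : R := if E i then 0 else t.
pose e i : R := (E i)%:R.
have g01 i : 0 <= g i <= 1 by rewrite /g; case: (E i) => //; rewrite lexx ler01.
have e01 i : 0 <= e i <= 1 by rewrite /e; case: (E i); rewrite /= ?lexx ?ler01.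
have eg01 i : 0 <= e i + g i <= 1.
  by rewrite /e /g; case: (E i) => /=; rewrite ?add0r ?addr0 // lexx ler01.
have sumg : \sum_(i < Q) g i = y * Q%:R - S.
  rewrite -tE mulrBl; apply/eqP; rewrite -subr_eq0 opprB addrA subr_eq0 -/S; apply/eqP.
  rewrite /S mulr_suml -big_split /=.
  rewrite (eq_bigr (fun=> t)); last first.
    by move=> i _; rewrite /g; case: (E i); rewrite /= ?add0r ?mul1r ?mul0r ?addr0.
  by rewrite sumr_const card_ord mulr_natl.
pose A := cells Q (fun i => e i + g i) Q; pose Ec := cells Q e Q; pose G := cells Q g Q.
apply: (@Delta_le R A).
- by apply: borel_Lmeasurable; exact: measurable_cells.
- move=> x Ax; change (x \in `[0, 1[); rewrite in_itv /=; apply/andP; split.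
    have [i _ /andP[+ _]] := mem_cells Q0 Ax.
    by rewrite -(pmulr_rge0 _ Q0') => /ltW; apply: le_trans.
  have := cells_sub Q0 (fun i => proj2 (andP (eg01 i))) Ax.
  by rewrite /= divff // gt_eqF.
- rewrite lambda_cells // big_split /= -/S sumg; congr EFin.
  by rewrite addrC subrK mulfK // gt_eqF.
- move=> c.
  have AEG : A `<=` Ec `|` G.
    move=> x [i iQ xi]; have [Ei|Ei] := boolP (E i); [left|right]; exists i => //;
    by move: xi; rewrite /e /g ?Ei ?(negbTE Ei) /= ?addr0 ?add0r.
  apply: (@le_trans _ _ (lambda ((Ec `&` refl c Ec) `|` (G `|` refl c G)))).
    apply: le_lambda => x [/AEG[xE|xG] /AEG[cE|cG]]; [left|right;right|right;left|right;left] => //.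
  apply: (le_trans (lambdaU _ _)); rewrite EFinD; apply: leeD.
    exact: lambda_cells_refl_le.
  apply: (le_trans (lambdaU _ _)); rewrite lambda_refl lambda_cells // sumg.
  by rewrite -EFinD lee_fin mulrBl mulfK ?gt_eqF//; lra.
Qed.
End cell_sets.

(** * Counting representations *)

Section combinatorics.
Local Open Scope nat_scope.

Lemma sum_divmod (V : nmodType) (F : nat -> V) T L :
  (\sum_(x < T * L) F x = \sum_(u < T) \sum_(t < L) F (u * L + t)%N)%R.
Proof.
elim: T => [|T IH]; first by rewrite mul0n !big_ord0.
rewrite big_ord_recr /= -IH mulSn addnC -!(big_mkord xpredT).
rewrite (@big_cat_nat _ _ _ (T * L)) //= ?leq_addr //; congr (_ + _)%R.
rewrite -{1}[T * L]add0n big_addn addKn big_mkord.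
by apply: eq_bigr => t _; rewrite addnC.
Qed.

(** Write [x = u * L + t] with [t < L]. For fixed [t <= k] the quotient of [k - x] is [m - u] with
    [m = (k - t) %/ L], so each of the [L] residues contributes one sum bounded by [B]. *)
Lemma sum_fold (R : numDomainType) (G : nat -> nat -> R) L k (B : R) :
  0 < L -> (0 <= B)%R -> (forall m, \sum_(u < m.+1) G u (m - u)%N <= B)%R ->
  (\sum_(x < k.+1) G (x %/ L)%N ((k - x) %/ L)%N <= L%:R * B)%R.
Proof.
move=> L0 B0 HB.
rewrite (big_ord_widen (k.+1 * L) (fun x => G (x %/ L) ((k - x) %/ L))); last first.
  by rewrite leq_pmulr.
rewrite big_mkcond.
rewrite (sum_divmod (fun x => if x < k.+1 then G (x %/ L) ((k - x) %/ L) else 0%R)).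
rewrite exchange_big /=.
rewrite mulr_natl -[in X in (_ <= _ *+ X)%R](card_ord L) -sumr_const.
apply: ler_sum => t _.
have [kt|tk] := ltnP k t.
  by rewrite big1 // => u _; case: ifP => //; lia.
set m := (k - t) %/ L.
have km : m < k.+1 by rewrite ltnS; apply: (leq_trans (leq_div _ _)); lia.
apply: le_trans (HB m).
rewrite (big_ord_widen k.+1 (fun u => G u (m - u)%N)) // [in leRHS]big_mkcond /=.
apply: ler_sum => u _.
have -> : (u * L + t < k.+1) = (u < m.+1).
  by rewrite !ltnS /m leq_divRL //; move: (u * L) => w; clear -tk; lia.
case: ifP => // um; rewrite divnMDl // [t %/ L]divn_small // addn0.
rewrite addnC subnDA -/m.
have {1}-> : k - t = m * L + (k - t) %% L by rewrite /m -divn_eq.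
have -> : m * L + (k - t) %% L - u * L = (m - u) * L + (k - t) %% L.
  by rewrite mulnBl addnBAC // leq_mul2r -ltnS um orbT.
by rewrite divnMDl // [((k - t) %% L) %/ L]divn_small ?addn0 ?ltn_mod.
Qed.

Lemma periodic_sum (g : nat -> bool) q lo : (forall x, g (x + q) = g x) ->
  \sum_(i < q) (g (lo + i) : nat) = \sum_(i < q) (g i : nat).
Proof.
move=> Hg; elim: lo => [|lo <-] //; case: q Hg => [|q] Hg; first by rewrite !big_ord0.
rewrite big_ord_recr big_ord_recl /= addn0 addnC.
rewrite -(Hg lo) addSnnS; congr (_ + _).
by apply: eq_bigr => i _; rewrite addSnnS.
Qed.

Lemma periodic_count_le (g : nat -> bool) q K lo len : 0 < q ->
  (forall x, g (x + q) = g x) -> \sum_(i < q) (g i : nat) <= K ->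
  \sum_(i < len) (g (lo + i) : nat) <= (len %/ q).+1 * K.
Proof.
move=> q0 Hg HK.
apply: (@leq_trans (\sum_(i < (len %/ q).+1 * q) (g (lo + i) : nat))).
  rewrite (big_ord_widen ((len %/ q).+1 * q) (fun i => g (lo + i) : nat)); last first.
    exact/ltnW/ltn_ceil.
  by rewrite big_mkcond; apply: leq_sum => i _; case: ifP.
rewrite (sum_divmod (fun i => g (lo + i) : nat)) -[X in _ <= X * _]card_ord -sum_nat_const.
apply: leq_sum => u _; apply: leq_trans HK.
under eq_bigr do rewrite addnA.
by rewrite periodic_sum.
Qed.

(** [p'.-1 * x] stands for [- x] modulo [p'] and avoids truncated subtraction. By the Chinese
    remainder theorem the two residues determine [x] below [p * p']. *)
Lemma crt_count p p' k k' s : 0 < p' -> coprime p p' ->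
  \sum_(x < p * p') ((x %% p < k) && ((s + p'.-1 * x) %% p' < k') : nat) <= k * k'.
Proof.
move=> p0 cop; pose P x := (x %% p < k) && ((s + p'.-1 * x) %% p' < k').
rewrite -(big_mkord xpredT (fun x => P x : nat)) /=.
rewrite (eq_bigr (fun x => if P x then 1 else 0)); last by move=> x _; case: P.
rewrite -big_mkcond /= sum1_count -size_filter.
pose h x := (x %% p, (s + p'.-1 * x) %% p').
have -> : k * k' = size (allpairs pair (iota 0 k) (iota 0 k')).
  by rewrite size_allpairs !size_iota.
rewrite -(size_map h).
apply: uniq_leq_size.
  rewrite map_inj_in_uniq ?filter_uniq ?iota_uniq // => x y.
  rewrite !mem_filter !mem_index_iota => /and3P[_ _ xp] /and3P[_ _ yp] [h1 h2].
  have h3 : x = y %[mod p'].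
    have /eqP := h2; rewrite eqn_modDl => /eqP h2'.
    have E z w : p'.-1 * z + (z + w) = z * p' + w.
      by rewrite addnA -mulSnr prednK // mulnC.
    have : p'.-1 * x + (x + y) = p'.-1 * y + (x + y) %[mod p'].
      by rewrite -modnDml h2' modnDml.
    by rewrite E [x + y]addnC E !modnMDl.
  have /eqP := h1; move/eqP: h3 => h3 h1'.
  have : x == y %[mod p * p'] by rewrite chinese_remainder // h1' h3.
  by rewrite !modn_small // => /eqP.
move=> _ /mapP[x + ->]; rewrite mem_filter => /andP[/andP[xk xk'] _].
by apply/allpairsP; exists (h x); rewrite !mem_iota.
Qed.

Lemma sum_interval (J g : nat -> bool) lo hi m : hi <= m ->
  (forall x, x < m -> J x = (lo <= x < hi)) ->
  \sum_(x < m) (J x && g x : nat) = \sum_(i < hi - lo) (g (lo + i) : nat).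
Proof.
move=> him HJ.
transitivity (\sum_(lo <= x < hi) (g x : nat)).
  rewrite big_geq_mkord (big_ord_widen_cond m (fun x => lo <= x) (fun x => g x : nat)) //.
  rewrite [RHS]big_mkcond; apply: eq_bigr => x _.
  by rewrite HJ //; case: (lo <= x < hi).
rewrite -{1}[lo]add0n big_addn big_mkord.
by apply: eq_bigr => i _; rewrite addnC.
Qed.

Lemma sum_lt_const N m : m <= N -> \sum_(x < N) (x < m : nat) = m.
Proof.
move=> mN; have := @sum_interval (fun x => x < m) xpredT 0 m N mN (fun _ _ => erefl).
rewrite subn0 sum1_card card_ord => E; rewrite -[RHS]E.
by apply: eq_bigr => x _; rewrite andbT.
Qed.

(** The [x] in block [i] with [m - x] in block [j] form an interval. The residue conditions have
    period [p * p'] there, with at most [k * k'] solutions per period; the successor accounts for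
    the incomplete period. *)
Lemma pair_count p p' k k' L m i j : 0 < p -> 0 < p' -> 0 < L -> coprime p p' ->
  \sum_(x < m.+1) ([&& x %/ L == i, (m - x) %/ L == j, x %% p < k & (m - x) %% p' < k'] : nat)
  <= ((\sum_(x < m.+1) ((x %/ L == i) && ((m - x) %/ L == j) : nat)) %/ (p * p')).+1 * (k * k').
Proof.
move=> p0 p'0 L0 cop.
pose lo := maxn (i * L) (m.+1 - j.+1 * L); pose hi := minn (i.+1 * L) (m.+1 - j * L).
pose J x := (x %/ L == i) && ((m - x) %/ L == j).
have eqdiv x l : (x %/ L == l) = (l * L <= x < l.+1 * L).
  by rewrite eqn_leq -ltnS ltn_divLR // leq_divRL // andbC.
have him : hi <= m.+1 by rewrite /hi; lia.
have HJ x : x < m.+1 -> J x = (lo <= x < hi).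
  rewrite /J !eqdiv /lo /hi; set jL := j * L; set jL' := j.+1 * L.
  have : jL <= jL' by rewrite leq_mul2r leqnSn orbT.
  by set iL := i * L; set iL' := i.+1 * L; clearbody iL iL' jL jL'; lia.
pose g x := (x %% p < k) && ((m + p'.-1 * x) %% p' < k').
rewrite (eq_bigr (fun x : 'I_m.+1 => J x && g x : nat)); last first.
  move=> x _; rewrite /J /g -andbA.
  have -> // : (m + p'.-1 * x) %% p' = (m - x) %% p'.
  have -> : m + p'.-1 * x = x * p' + (m - x).
    by case: x => x /=; rewrite ltnS => xm; case: (p') p'0 => // q _ /=; nia.
  by rewrite modnMDl.
rewrite (sum_interval g him HJ).
rewrite (eq_bigr (fun x : 'I_m.+1 => J x && xpredT x : nat)); last by move=> x _; rewrite andbT.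
rewrite (sum_interval xpredT him HJ) sum1_card card_ord.
apply: periodic_count_le; first by rewrite muln_gt0 p0.
  move=> x; rewrite /g; congr (_ && _); first by rewrite addnC mulnC modnMDl.
  by rewrite mulnDr addnA [X in _ + X]mulnA addnC modnMDl.
exact: crt_count.
Qed.

End combinatorics.

(** * Thinning a step function to a set of integers *)

Section thinning.
Variable R : archiRealFieldType.

(** Iterating [prime_above] from [K] gives increasing primes; their size makes the rounding of
    densities to multiples of [1 / p i] harmless. *)
Lemma coprime_family K : exists p : nat -> nat,
  (forall i, prime (p i) /\ (K < p i)%N) /\
  (forall i j, i != j -> coprime (p i) (p j)).
Proof.
pose f m := s2val (prime_above m).
have fP m : (m < f m)%N /\ prime (f m).
  by split; [exact: (s2valP (prime_above m)) | exact: (s2valP' (prime_above m))].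
pose p i := iter i.+1 f K.
have pS i : (p i < p i.+1)%N by case: (fP (p i)).
have plt i j : (i < j)%N -> (p i < p j)%N.
  elim: j => // j IH; rewrite ltnS leq_eqVlt => /orP[/eqP ->|/IH h]; first exact: pS.
  exact: ltn_trans h (pS j).
have pp i : prime (p i) by case: (fP (iter i f K)).
exists p; split => [i|i j ij].
  split; first exact: pp.
  have Kp : (K < p 0)%N by case: (fP K).
  by case: i => // i; apply: ltn_trans Kp (plt _ _ _).
rewrite prime_coprime ?pp // dvdn_prime2 ?pp //.
apply/eqP => pij; case: (ltngtP i j) ij => // /plt; by rewrite pij ltnn.
Qed.

(* Block [i] of length [L] keeps the integers whose residue modulo [p i] is below [kk i].
   For blocks [i != j] the Chinese remainder theorem makes the conditions on [x] and
   [m - x] independent; the diagonal [i = j] only costs [L]. *)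
Lemma thin_size n (p kk : nat -> nat) c L (E : pred nat) :
  (forall i, (0 < p i)%N) -> (forall i, (kk i <= p i)%N) ->
  L = (c * \prod_(i < n) p i)%N ->
  (forall x, E x = (x < n * L)%N && (x %% p (x %/ L)%N < kk (x %/ L)%N)%N) ->
  \sum_(x < n * L) (E x)%:R = L%:R * \sum_(u < n) ((kk u)%:R / (p u)%:R) :> R.
Proof.
move=> p0 kp LE HE.
rewrite (sum_divmod (fun x => (E x)%:R)) mulr_sumr; apply: eq_bigr => u _.
have pu0 : (p u)%:R != 0 :> R by rewrite pnatr_eq0 -lt0n.
have [q Lq] : exists q, L = (q * p u)%N.
  by exists (c * \prod_(i < n | i != u) p i)%N; rewrite LE (bigD1 u) //= mulnA mulnAC.
have [->|q0] := posnP L; first by rewrite big_ord0 mul0r.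
rewrite (eq_bigr (fun t : 'I_L => (t %% p u < kk u)%N%:R)); last first.
  move=> t _; rewrite HE divnMDl // divn_small // addn0.
  have -> : (u * L + t < n * L)%N.
    apply: (@leq_trans (u.+1 * L)); last by rewrite leq_mul2r ltn_ord orbT.
    by rewrite mulSn addnC ltn_add2r.
  by rewrite [in (u * L)%N]Lq mulnA modnMDl.
rewrite -(big_mkord xpredT (fun t => (t %% p u < kk u)%N%:R)) Lq big_mkord.
rewrite (sum_divmod (fun t => (t %% p u < kk u)%N%:R)).
rewrite (eq_bigr (fun=> (kk u)%:R)); last first.
  move=> i _; rewrite (eq_bigr (fun t : 'I_(p u) => (t < kk u)%N%:R)); last first.
    by move=> t _; rewrite modnMDl modn_small.
  by rewrite -natr_sum sum_lt_const.
by rewrite sumr_const card_ord natrM -mulrA [(p u)%:R * _]mulrC divfK // mulr_natl.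
Qed.

Lemma thin_reps n (a : nat -> R) (p kk : nat -> nat) L (E : pred nat) (B : R) m :
  (0 < L)%N -> (forall i, 0 <= a i <= 1) ->
  (forall i, (0 < p i)%N) -> (forall i j, i != j -> coprime (p i) (p j)) ->
  (forall i, (kk i)%:R <= a i * (p i)%:R) ->
  (forall x, E x -> (x %/ L < n)%N && (x %% p (x %/ L)%N < kk (x %/ L)%N)%N) ->
  (forall k, \sum_(u < k.+1) a u * a (k - u)%N <= B) ->
  (reps E m)%:R <= L%:R * (B + 1) + (\sum_(i < n) p i)%:R ^+ 2 * n%:R ^+ 2.
Proof.
move=> L0 a01 p0 cop kkp HE HB; set P := (\sum_(i < n) p i)%N.
pose T i j x := [&& x %/ L == i, (m - x) %/ L == j, x %% p i < kk i & (m - x) %% p j < kk j]%N.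
pose I i j x := ((x %/ L == i) && ((m - x) %/ L == j))%N.
pose D x := (x %/ L == (m - x) %/ L)%N.
have B0 : 0 <= B.
  apply: le_trans (HB 0%N); rewrite big_ord1 subnn.
  by apply: mulr_ge0; case/andP: (a01 0%N).
(* Representations of [m] are sorted by the blocks of their two summands; [D] collects those with
   both in one block. *)
have step1 : (reps E m <= \sum_(x < m.+1) D x +
    \sum_(i < n) \sum_(j < n | j != i :> nat) \sum_(x < m.+1) T i j x)%N.
  rewrite [X in (_ <= _ + X)%N](eq_bigr (fun i : 'I_n => 
    \sum_(x < m.+1) \sum_(j < n | j != i :> nat) T i j x))%N; last first.
    by move=> i _; rewrite exchange_big.
  rewrite exchange_big /= -big_split /=; apply: leq_sum => x _.
  case: (boolP (E x)) => //= /HE /andP[xn xk].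
  case: (boolP (E (m - x)%N)) => //= /HE /andP[yn yk].
  rewrite /D; case: eqP => //= /eqP xy.
  rewrite (bigD1 (Ordinal xn)) //= (bigD1 (Ordinal yn)) /=; last by rewrite eq_sym.
  by rewrite /T !eqxx xk yk.
have pP i : (i < n)%N -> (p i <= P)%N.
  by move=> ni; rewrite /P (bigD1 (Ordinal ni)) //= leq_addr.
(* The main term counts the admissible [x] with density [a i * a j]; the incomplete period adds at
   most [p i * p j], hence at most [P ^+ 2]. *)
have step2 i j : (i < n)%N -> (j < n)%N -> j != i ->
  (\sum_(x < m.+1) T i j x)%:R <= \sum_(x < m.+1) (I i j x)%:R * (a i * a j) + P%:R ^+ 2.
  move=> ni nj ji.
  have cij : coprime (p i) (p j) by apply: cop; rewrite eq_sym.
  have := @pair_count (p i) (p j) (kk i) (kk j) L m i j (p0 i) (p0 j) L0 cij.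
  rewrite -/(T i j) -(ler_nat R) => /le_trans; apply.
  rewrite -mulr_suml -natr_sum.
  set l := (\sum_(x < m.+1) _)%N; rewrite -/l.
  have pij0 : 0 < (p i * p j)%:R :> R by rewrite ltr0n muln_gt0 !p0.
  have kk1 : (kk i * kk j)%:R <= (a i * a j) * (p i * p j)%:R :> R.
    by rewrite !natrM mulrACA; apply: ler_pM.
  have aij : a i * a j <= 1.
    have := a01 i; have := a01 j => /andP[? ?] /andP[? ?].
    by rewrite -[1]mul1r; apply: ler_pM.
  have aij0 : 0 <= a i * a j.
    by have := a01 i; have := a01 j => /andP[? ?] /andP[? ?]; apply: mulr_ge0.
  rewrite natrM -natr1 mulrDl mul1r; apply: lerD.
    apply: (@le_trans _ _ ((l %/ (p i * p j))%:R * ((a i * a j) * (p i * p j)%:R))).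
      by apply: ler_wpM2l.
    rewrite mulrCA mulrC; apply: ler_wpM2r => //.
    by rewrite -natrM ler_nat; exact: leq_trunc_div.
  apply: (le_trans kk1); apply: (@le_trans _ _ ((p i * p j)%:R)).
    by rewrite ler_piMl // ltW.
  by rewrite -natrX ler_nat -mulnn leq_mul // pP.
have step3 : \sum_(i < n) \sum_(j < n | j != i :> nat) \sum_(x < m.+1) (I i j x)%:R * (a i * a j)
   <= \sum_(x < m.+1) a (x %/ L)%N * a ((m - x) %/ L)%N.
  apply: (@le_trans _ _ (\sum_(i < n) \sum_(j < n) \sum_(x < m.+1) (I i j x)%:R * (a i * a j))).
    apply: ler_sum => i _; rewrite [leLHS]big_mkcond; apply: ler_sum => j _.
    case: ifP => // _; apply: sumr_ge0 => x _; apply: mulr_ge0 => //.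
    by have := a01 i; have := a01 j => /andP[? ?] /andP[? ?]; apply: mulr_ge0.
  under eq_bigr do rewrite exchange_big.
  rewrite exchange_big; apply: ler_sum => x _.
  set u := (x %/ L)%N; set v := ((m - x) %/ L)%N.
  have /andP[u0 _] := a01 u; have /andP[v0 _] := a01 v.
  have inner i : \sum_(j < n) (I i j x)%:R * (a i * a j) <= (u == i)%:R * (a i * a v).
    have [nv|vn] := ltnP v n; last first.
      rewrite big1 ?mulr_ge0 //; first by case/andP: (a01 i).
      move=> j _; rewrite /I -/v; case: (v =P j); rewrite ?andbF ?mul0r // => vj.
      by rewrite vj leqNgt ltn_ord in vn.
    rewrite (bigD1 (Ordinal nv)) //= big1 ?addr0; first by rewrite /I -/v eqxx andbT.
    by move=> j jv; rewrite /I -/v; case: (v =P j) => [vj|]; rewrite ?andbF ?mul0r //;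
      move: jv; rewrite -val_eqE /= vj eqxx.
  apply: (@le_trans _ _ (\sum_(i < n) (u == i)%:R * (a i * a v))); first exact: ler_sum.
  have [nu|un] := ltnP u n; last first.
    rewrite big1 ?mulr_ge0 // => i _; case: eqP; rewrite ?mul0r // => ui.
    by rewrite ui leqNgt ltn_ord in un.
  rewrite (bigD1 (Ordinal nu)) //= big1 ?addr0; first by rewrite eqxx mul1r.
  by move=> i iu; case: eqP => [ui|]; rewrite ?mul0r //; move: iu; rewrite -val_eqE /= ui eqxx.
(* Folding by [L] bounds the main term and the diagonal at once. For each [k] at most one [u]
   satisfies [u = k - u], whence [B + 1]. *)
apply: (@le_trans _ _ (\sum_(x < m.+1) (a (x %/ L)%N * a ((m - x) %/ L)%N
    + (x %/ L == (m - x) %/ L)%N%:R) + P%:R ^+ 2 * n%:R ^+ 2)); last first.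
  rewrite lerD2r.
  apply: (@sum_fold R (fun u v => a u * a v + (u == v)%N%:R)) => //; first exact: addr_ge0.
  move=> k; rewrite big_split /=; apply: lerD; first exact: HB.
  rewrite -natr_sum lern1.
  have [/existsP[u /eqP uk]|] := boolP [exists u : 'I_k.+1, nat_of_ord u == (k - u)%N].
    rewrite (bigD1 u) //= big1 ?addn0 ?leq_b1 // => i iu.
    case: eqP => // ik; have : i = u :> nat by lia.
    by move/val_inj => iu'; rewrite iu' eqxx in iu.
  rewrite negb_exists => /forallP H; rewrite big1 // => u _.
  by rewrite (negbTE (H u)).
rewrite big_split /= -natr_sum.
have := step1; rewrite -(ler_nat R) => /le_trans; apply.
rewrite natrD [X in _ <= X + _]addrC -addrA; apply: lerD => //.
rewrite natr_sum; apply: le_trans (_ : _ <= \sum_(i < n) 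
  (\sum_(j < n | j != i :> nat) \sum_(x < m.+1) (I i j x)%:R * (a i * a j) + P%:R ^+ 2 * n%:R)) _; last first.
  rewrite big_split /=; apply: lerD => //.
  by rewrite sumr_const card_ord -[leLHS]mulr_natr -mulrA.
apply: ler_sum => i _; rewrite natr_sum.
apply: (@le_trans _ _ (\sum_(j < n | j != i :> nat) 
   (\sum_(x < m.+1) (I i j x)%:R * (a i * a j) + P%:R ^+ 2))).
  by apply: ler_sum => j ji; exact: step2.
rewrite big_split /= lerD2l sumr_const -[leLHS]mulr_natr ler_wpM2l ?exprn_ge0 //.
by rewrite ler_nat -[leqRHS]card_ord max_card.
Qed.

(** The term [n^-1] is the diagonal cost [L] relative to [Q = n * L], and the [eta] beside it
    absorbs the incomplete periods. The [eta] in the density pays for rounding down the residue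
    counts, as every prime exceeds [eta^-1]. *)
Lemma thinning n (a : nat -> R) (M eta : R) : (0 < n)%N ->
  (forall i, 0 <= a i <= 1) ->
  (forall k, \sum_(u < k.+1) a u * a (k - u)%N <= n%:R * M) -> 0 < eta ->
  exists (Q : nat) (E : pred nat), [/\ (0 < Q)%N, forall x, E x -> (x < Q)%N,
    (\sum_(i < n) a i) / n%:R - eta <= (\sum_(x < Q) (E x)%:R) / Q%:R <= (\sum_(i < n) a i) / n%:R
    & forall k, (reps E k)%:R <= Q%:R * (M + n%:R^-1 + eta)].
Proof.
move=> n0 a01 HM eta0; have n0' : 0 < n%:R :> R by rewrite ltr0n.
have [p [pK cop]] := coprime_family (Num.trunc eta^-1).+1.
have p0 i : (0 < p i)%N by case: (pK i) => /prime_gt0.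
have p0' i : 0 < (p i)%:R :> R by rewrite ltr0n.
have peta i : (p i)%:R^-1 <= eta.
  rewrite -[leRHS]invrK lef_pV2 ?posrE ?invr_gt0 //.
  have /andP[_ /ltW] : (Num.trunc eta^-1)%:R <= eta^-1 < (Num.trunc eta^-1).+1%:R.
    by apply: truncn_itv; rewrite invr_ge0 ltW.
  by move=> /le_trans; apply; rewrite ler_nat; case: (pK i) => _ /ltnW.
pose kk i := Num.trunc (a i * (p i)%:R).
have kkP i : (kk i)%:R <= a i * (p i)%:R < (kk i).+1%:R.
  by apply: truncn_itv; apply: mulr_ge0 => //; case/andP: (a01 i).
have kp i : (kk i <= p i)%N.
  rewrite -(ler_nat R); have /andP[/le_trans + _] := kkP i; apply.
  by rewrite ler_piMl //; case/andP: (a01 i).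
pose P := (\sum_(i < n) p i)%N; pose Pi := (\prod_(i < n) p i)%N.
have Pi0 : (0 < Pi)%N by rewrite /Pi prodn_gt0.
(* [c] makes the blocks long enough for the error [P ^+ 2 * n ^+ 2] to stay below
   [L * (n * eta)]. *)
pose c := (Num.trunc (n%:R * P%:R ^+ 2 / eta)).+1.
have cP : P%:R ^+ 2 * n%:R ^+ 2 <= c%:R * (n%:R * eta).
  have /andP[_ /ltW] : (Num.trunc (n%:R * P%:R ^+ 2 / eta))%:R <= n%:R * P%:R ^+ 2 / eta < c%:R.
    by apply: truncn_itv; rewrite divr_ge0 ?mulr_ge0 ?exprn_ge0 // ltW.
  rewrite ler_pdivrMr // => /(ler_wpM2l (ltW n0')) H.
  by rewrite [leRHS]mulrCA; apply: le_trans H; rewrite [leRHS]mulrA -expr2 mulrC.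
pose L := (c * Pi)%N; have L0 : (0 < L)%N by rewrite muln_gt0.
have L0' : 0 < L%:R :> R by rewrite ltr0n.
pose E x := (x < n * L)%N && (x %% p (x %/ L) < kk (x %/ L))%N.
have SE := @thin_size n p kk c L E p0 kp (erefl _) (fun=> erefl _).
have avg : (\sum_(x < n * L) (E x)%:R) / (n * L)%:R = (\sum_(u < n) (kk u)%:R / (p u)%:R) / n%:R :> R.
  by rewrite SE natrM; field; rewrite !gt_eqF.
exists (n * L)%N, E; split.
- by rewrite muln_gt0 n0.
- by move=> x /andP[].
- rewrite avg; apply/andP; split; last first.
    rewrite ler_pM2r ?invr_gt0 //; apply: ler_sum => i _.
    by rewrite ler_pdivrMr //; case/andP: (kkP i).
  rewrite lerBlDr.
  have -> : eta = (\sum_(i < n) eta) / n%:R.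
    by rewrite sumr_const card_ord -[eta *+ n]mulr_natr mulfK // gt_eqF.
  rewrite -mulrDl ler_pM2r ?invr_gt0 // -big_split /=; apply: ler_sum => i _.
  apply: (@le_trans _ _ ((kk i)%:R / (p i)%:R + (p i)%:R^-1)); last by rewrite lerD2l.
  rewrite -[X in _ + X]mul1r -mulrDl ler_pdivlMr // natr1.
  by case/andP: (kkP i) => _ /ltW.
- move=> k.
  have HE x : E x -> (x %/ L < n)%N && (x %% p (x %/ L)%N < kk (x %/ L)%N)%N.
    by case/andP => xn ->; rewrite ltn_divLR // xn.
  apply: le_trans (thin_reps k L0 a01 p0 cop (fun i => proj1 (andP (kkP i))) HE HM) _.
  have LcP : P%:R ^+ 2 * n%:R ^+ 2 <= L%:R * (n%:R * eta).
    apply: (le_trans cP); rewrite ler_wpM2r ?mulr_ge0 ?(ltW eta0) // ler_nat.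
    by rewrite /L leq_pmulr.
  have -> : (n * L)%:R * (M + n%:R^-1 + eta) = L%:R * (n%:R * M + 1) + L%:R * (n%:R * eta) :> R.
    by rewrite natrM; field; rewrite gt_eqF.
  by rewrite lerD2l.
Qed.

End thinning.

(** * Upper bounds *)

Section upper_bound.
Variable R : realType.

(* Subdividing the steps [m] times removes the error [1 / n] left by [thinning]. *)
Lemma Delta_step n (a : nat -> R) (M y : R) : (0 < n)%N ->
  (forall i, 0 <= a i <= 1) ->
  (forall k, \sum_(u < k.+1) a u * a (k - u)%N <= n%:R * M) ->
  (\sum_(i < n) a i) / n%:R <= y <= 1 ->
  (Delta y <= (M + 2 * (y - (\sum_(i < n) a i) / n%:R))%:E)%E.
Proof.
move=> n0 a01 HM /andP[ay y1]; set s := _ / _ in ay *.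
have n0' : 0 < n%:R :> R by rewrite ltr0n.
apply/lee_addgt0Pr => e e0.
(* The errors are [1 / (n * m)], [eta] in the autoconvolution and [2 * eta] from the density; with
   [eta = e / 4] they add up to at most [e]. *)
have [m [m0 me]] : exists m : nat, (0 < m)%N /\ m%:R^-1 <= e / 4.
  exists (Num.trunc (4 / e)).+1; split => //.
  rewrite -[leRHS]invrK lef_pV2 ?posrE ?invr_gt0 ?divr_gt0 // invf_div.
  suff /andP[_ /ltW] : (Num.trunc (4 / e))%:R <= 4 / e < (Num.trunc (4 / e)).+1%:R by [].
  by apply: truncn_itv; rewrite divr_ge0 // ltW.
have m0' : 0 < m%:R :> R by rewrite ltr0n.
have nM0 : 0 <= n%:R * M.
  apply: le_trans (HM 0%N); rewrite big_ord1 subnn.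
  by apply: mulr_ge0; case/andP: (a01 0%N).
pose a' i := a (i %/ m)%N.
have HM' k : \sum_(u < k.+1) a' u * a' (k - u)%N <= (n * m)%:R * M.
  rewrite natrM mulrAC mulrC.
  exact: (@sum_fold R (fun u v => a u * a v)).
have s' : (\sum_(i < n * m) a' i) / (n * m)%:R = s.
  rewrite (sum_divmod a') (eq_bigr (fun i : 'I_n => a i * m%:R)); last first.
    move=> i _; rewrite (eq_bigr (fun=> a i)) ?sumr_const ?card_ord ?mulr_natr //.
    by move=> t _; rewrite /a' divnMDl // divn_small // addn0.
  by rewrite -mulr_suml natrM -mulf_div divff ?gt_eqF // mulr1.
have nm0 : (0 < n * m)%N by rewrite muln_gt0 n0.
have e40 : 0 < e / 4 by rewrite divr_gt0.
have [Q [E [Q0 EQ]]] := thinning nm0 (fun i => a01 (i %/ m)%N) HM' e40.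
rewrite s' => /andP[sE Es] HE.
have yE : (\sum_(x < Q) (E x)%:R) / Q%:R <= y <= 1 by rewrite (le_trans Es).
apply: (le_trans (Delta_cells Q0 EQ HE yE)); rewrite -EFinD lee_fin.
have : (n * m)%:R^-1 <= m%:R^-1 :> R.
  by rewrite lef_pV2 ?posrE ?ltr0n // ler_nat leq_pmull.
by lra.
Qed.

End upper_bound.

(** * A discrete beta integral bounded by pi *)

Section beta_sum.
Import numFieldNormedType.Exports.
Variable R : realType.

(** Mean value theorem for [cos] between [acos v] and [acos w]: the hypothesis bounds [sin] by [s]
    there, since [sin ^ 2 = 1 - cos ^ 2]. *)
Lemma acos_diff (v w s : R) : -1 <= w -> w <= v -> v <= 1 -> 0 <= s ->
  (forall z, w <= z <= v -> 1 - z ^+ 2 <= s ^+ 2) ->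
  v - w <= s * (acos w - acos v).
Proof.
move=> w1 wv v1 s0 H.
have vI : v \in `[-1, 1] by rewrite in_itv /= v1 (le_trans w1).
have wI : w \in `[-1, 1] by rewrite in_itv /= w1 (le_trans wv).
have cI (z : R) : z \in `[-1, 1] -> acos z \in `[0, pi].
  by rewrite !in_itv /= => zI; rewrite acos_ge0 ?acos_lepi.
have vw : acos v <= acos w.
  by rewrite leNgt -ltr_cos ?cI // !acosK // -leNgt.
have ct : {within `[acos v, acos w], continuous (@cos R)}.
  by apply: continuous_subspaceT; exact: continuous_cos.
have [xi xiI] := @MVT_segment R cos (fun x => - sin x) (acos v) (acos w) vw
  (fun x _ => is_derive_cos x) ct.
rewrite !acosK // => E.
have xipi : xi \in `[0, pi].
  move: xiI (cI _ vI) (cI _ wI); rewrite !in_itv /= => /andP[? ?] /andP[? ?] /andP[? ?].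
  by apply/andP; split; lra.
have cxi : w <= cos xi <= v.
  move: xiI; rewrite in_itv /= => /andP[h1 h2].
  apply/andP; split.
    by rewrite -[X in X <= _](acosK wI) leNgt ltr_cos ?cI // -leNgt.
  by rewrite -[X in _ <= X](acosK vI) leNgt ltr_cos ?cI // -leNgt.
have sxi : sin xi <= s.
  rewrite -[leRHS]ger0_norm // -[leRHS]sqrtr_sqr.
  rewrite -[leLHS]ger0_norm; last by apply: sin_ge0_pi; move: xipi; rewrite in_itv.
  rewrite -sqrtr_sqr ler_wsqrtr // sin2cos2; exact: H.
have : v - w = sin xi * (acos w - acos v) by lra.
move=> ->; apply: ler_wpM2r => //; by rewrite subr_ge0.
Qed.

(* A Riemann sum of the beta integral of [(x (1 - x)) ^ (-1/2)], whose primitive is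
   [acos (1 - 2 x)]: each term is at most the increment of the primitive over an
   adjacent cell, on the side away from the middle. *)
Lemma beta_sum k :
  \sum_(u < k.+1) (Num.sqrt u.+1%:R)^-1 * (Num.sqrt (k - u).+1%:R)^-1 <= pi :> R.
Proof.
pose K : R := k.+2%:R; have K0 : 0 < K by rewrite ltr0n.
pose z j : R := 1 - 2 * j%:R / K.
have z_le i j : (i <= j)%N -> z j <= z i.
  move=> ij; rewrite /z lerD2l lerN2 ler_pM2r ?invr_gt0 // ler_pM2l // ?ler_nat //.
have zk j : (j <= k.+2)%N -> -1 <= z j.
  move=> jk; apply: le_trans (z_le _ _ jk); rewrite /z mulfK ?gt_eqF //; lra.
have z1 j : z j <= 1 by rewrite /z gerDl oppr_le0 divr_ge0 ?mulr_ge0 // ltW.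
have zS j : z j - z j.+1 = 2 / K by rewrite /z -natr1; field; rewrite gt_eqF.
pose al j := acos (z j).
have al_mono i j : (i <= j <= k.+2)%N -> al i <= al j.
  case/andP => ij jk; have ik := leq_trans ij jk.
  rewrite leNgt -ltr_cos ?acosK ?in_itv /= ?acos_ge0 ?acos_lepi ?zk ?z1 // -leNgt.
  exact: z_le.
(* With [a = u + 1] and [b = k - u + 1] one has [K = a + b] and [z u.+1 = (b - a) / K]; this is
   [4 a b = (a + b) ^ 2 - (b - a) ^ 2] divided by [K ^ 2]. *)
have half u (s := (2 / K) * (Num.sqrt u.+1%:R * Num.sqrt (k - u).+1%:R)) :
    (u <= k)%N -> s ^+ 2 = 1 - z u.+1 ^+ 2.
  move=> uk; rewrite /s !exprMn !sqr_sqrtr // /z /K.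
  have -> : k.+2%:R = u.+1%:R + (k - u).+1%:R :> R by rewrite -natrD; congr (_%:R); lia.
  move: (ltr0Sn R u) (ltr0Sn R (k - u)); move: u.+1%:R (k - u).+1%:R => a b a0 b0.
  by field; rewrite gt_eqF // addr_gt0.
have bound u (i : nat) : (u <= k)%N -> (i.+1 <= k.+2)%N ->
   (forall t, z i.+1 <= t <= z i -> 1 - t ^+ 2 <= 1 - z u.+1 ^+ 2) ->
   (Num.sqrt u.+1%:R)^-1 * (Num.sqrt (k - u).+1%:R)^-1 <= al i.+1 - al i.
  move=> uk ik H; have zz : z i.+1 <= z i by exact: z_le.
  have s0 : 0 < Num.sqrt u.+1%:R * Num.sqrt (k - u).+1%:R :> R.
    by rewrite mulr_gt0 ?sqrtr_gt0.
  have s1 : 0 <= (2 / K) * (Num.sqrt u.+1%:R * Num.sqrt (k - u).+1%:R).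
    by rewrite mulr_ge0 ?divr_ge0 // ltW.
  have := @acos_diff (z i) (z i.+1) _ (zk _ ik) zz (z1 i) s1.
  rewrite half // => /(_ H); rewrite zS -/(al i) -/(al i.+1).
  move=> H2; rewrite -[leRHS]mulrA ler_pMr ?divr_gt0 // in H2.
  by rewrite -invfM -[leLHS]mul1r ler_pdivrMr // mulrC.
(* Left of the middle, term [u] is charged to the cell ending at node [u + 1]; right of it, to the
   cell starting there. The index shift in [ga] jumps over the cell between, so that the charges
   telescope. *)
pose ga j := if (2 * j <= k.+2)%N then al j else al j.+1.
apply: (@le_trans _ _ (\sum_(u < k.+1) (ga u.+1 - ga u))).
  apply: ler_sum => u _; have uk : (u <= k)%N by rewrite -ltnS.
  have uk1 : (u < k.+2)%N by rewrite ltnW // ltnS.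
  have uk2 : (u.+1 < k.+2)%N by rewrite !ltnS.
  have zmid j : (2 * j <= k.+2)%N -> 0 <= z j.
    move=> jk; rewrite /z subr_ge0 ler_pdivrMr // mul1r -natrM ler_nat //.
  have zmid' j : (k.+2 <= 2 * j)%N -> z j <= 0.
    move=> jk; rewrite /z subr_le0 ler_pdivlMr // mul1r -natrM ler_nat //.
  have [h|h] := leqP (2 * u.+1) k.+2.
    have h' : (2 * u <= k.+2)%N by clear -h; lia.
    rewrite /ga h h'.
    apply: bound => // t /andP[t1 t2].
    by have := zmid _ h; rewrite lerD2l lerN2 => ?; nra.
  apply: (@le_trans _ _ (al u.+2 - al u.+1)).
    apply: bound => // t /andP[t1 t2].
    by have := zmid' _ (ltnW h); rewrite lerD2l lerN2 => ?; nra.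
  rewrite /ga leqNgt h /=; case: ifP => _ //; rewrite lerD2l lerN2.
  by apply: al_mono; clear -uk; lia.
rewrite -(big_mkord xpredT (fun u => ga u.+1 - ga u)) telescope_sumr //.
have -> : ga 0%N = 0 by rewrite /ga /= /al /z !mulr0 mul0r subr0 acos1.
rewrite subr0 /ga; case: ifP => _; apply: acos_lepi; by rewrite zk ?z1.
Qed.

End beta_sum.

(** * The two explicit densities *)

Section explicit_densities.
Variable R : realType.

(* The density [1, 0, 1/2, 1, 0, 1, 1, 1] (doubled) on the eighths of [[0, 1[]. *)
Definition step8 (i : nat) : nat := nth 0%N [:: 2; 0; 1; 2; 0; 2; 2; 2]%N i.

Lemma step8_conv k : (\sum_(u < k.+1) step8 u * step8 (k - u) <= 12)%N.
Proof.
have [k15|k15] := ltnP k 15.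
  by do 15 (case: k k15 => [_|k k15]; first by rewrite !big_ord_recl big_ord0).
rewrite big1 // => u _; have [u8|u8] := ltnP u 8.
  by rewrite /step8 [X in (_ * X)%N]nth_default ?muln0 //=; lia.
by rewrite /step8 nth_default.
Qed.

(** The scaled density has mean [11 / 16 * t] and autoconvolution at most [3 / 8 * t ^+ 2]. Taking
    [t = 1] gives [2 y - 1], and [t = 16 / 11 * y] gives [96 / 121 * y ^+ 2]. *)
Lemma Delta_step8 (t y : R) : 0 <= t <= 1 -> 11 / 16 * t <= y <= 1 ->
  (Delta y <= (3 / 8 * t ^+ 2 + 2 * (y - 11 / 16 * t))%:E)%E.
Proof.
move=> /andP[t0 t1] ty; pose a i := t * (step8 i)%:R / 2.
have a01 i : 0 <= a i <= 1.
  have : (step8 i <= 2)%N.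
    by rewrite /step8; do 8 (case: i => [|i] //); rewrite nth_default.
  rewrite -(ler_nat R) => w2; have w0 : 0 <= (step8 i)%:R :> R by [].
  by rewrite /a; apply/andP; split; nra.
have HM k : \sum_(u < k.+1) a u * a (k - u)%N <= 8%:R * (3 / 8 * t ^+ 2).
  rewrite (eq_bigr (fun u : 'I_k.+1 => t ^+ 2 / 4 * (step8 u * step8 (k - u))%:R)); last first.
    by move=> u _; rewrite /a natrM; field.
  rewrite -mulr_sumr -natr_sum.
  have := step8_conv k; rewrite -(ler_nat R); set s := (\sum_(_ < _) _)%N => s12.
  have := sqr_ge0 t; nra.
have avg : (\sum_(i < 8) a i) / 8%:R = 11 / 16 * t.
  rewrite /a -mulr_suml -mulr_sumr -natr_sum.
  have -> : (\sum_(i < 8) step8 i = 11)%N by rewrite !big_ord_recl big_ord0.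
  by field.
by rewrite -avg in ty *; exact: Delta_step.
Qed.

Section truncated_sqrt.
Variables (n : nat) (b : R).
Hypotheses (n0 : (0 < n)%N) (b01 : 0 <= b <= 1).

(* [trunc_prim j / n] is the integral of [min(1, b / sqrt x)] over [[0, j/n]]. *)
Definition trunc_prim (j : nat) : R :=
  if Num.sqrt j%:R <= b * Num.sqrt n%:R then j%:R
  else 2 * (b * Num.sqrt n%:R) * Num.sqrt j%:R - (b * Num.sqrt n%:R) ^+ 2.

(** The increment is the mean over [[j, j + 1]] of a decreasing function with values in [0, 1],
    hence at most its value at [j]. *)
Lemma trunc_primS j : [/\ 0 <= trunc_prim j.+1 - trunc_prim j,
  trunc_prim j.+1 - trunc_prim j <= 1 &
  (trunc_prim j.+1 - trunc_prim j) * Num.sqrt j%:R <= b * Num.sqrt n%:R].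
Proof.
rewrite /trunc_prim; set B := b * _; set s := Num.sqrt j%:R; set t := Num.sqrt j.+1%:R.
have B0 : 0 <= B by rewrite mulr_ge0 ?sqrtr_ge0; case/andP: b01.
have s0 : 0 <= s by rewrite sqrtr_ge0.
have st : s <= t by rewrite ler_wsqrtr // ler_nat.
have t2 : t ^+ 2 = s ^+ 2 + 1 by rewrite !sqr_sqrtr // natr1.
have jE : j%:R = s ^+ 2 by rewrite sqr_sqrtr.
have jE' : j.+1%:R = t ^+ 2 by rewrite sqr_sqrtr.
rewrite jE jE'; clearbody s t B.
have ts : 0 <= t - s by lra.
have tsS : (t - s) * (t + s) = 1 by lra.
case: (leP t B) => tB; case: (leP s B) => sB; first by rewrite t2; split; lra.
- by exfalso; lra.
- have d1 : 2 * B * t - B ^+ 2 - s ^+ 2 <= 1 by have := sqr_ge0 (t - B); lra.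
  split=> //.
    have : 0 <= B * (t - B) by apply: mulr_ge0 => //; lra.
    have : 0 <= (B - s) * (B + s) by apply: mulr_ge0; lra.
    by lra.
  by apply: le_trans sB; rewrite ler_piMl.
- have BE : 2 * B * t - B ^+ 2 - (2 * B * s - B ^+ 2) = B * (2 * (t - s)) by ring.
  have ts2 : 2 * (t - s) * s <= 1.
    by have := mulr_ge0 ts ts; lra.
  rewrite BE; split; first by rewrite mulr_ge0 ?mulr_ge0.
    have tsB : 0 <= t + s - 2 * B by lra.
    by have := mulr_ge0 ts tsB; lra.
  by rewrite -mulrA ler_piMr.
Qed.

Lemma trunc_prim1 : 0 <= trunc_prim 1 <= 1.
Proof.
have p0 : trunc_prim 0 = 0.
  by rewrite /trunc_prim sqrtr0 mulr_ge0 ?sqrtr_ge0; case/andP: b01.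
by have [+ + _] := trunc_primS 0; rewrite p0 subr0 => -> ->.
Qed.

Lemma trunc_primn : trunc_prim n = n%:R * (2 * b - b ^+ 2).
Proof.
have /andP[b0 b1] := b01; have s0 : 0 < Num.sqrt n%:R :> R by rewrite sqrtr_gt0 ltr0n.
have nE : n%:R = Num.sqrt n%:R ^+ 2 :> R by rewrite sqr_sqrtr.
rewrite /trunc_prim; case: ifP => [|_].
  rewrite -{1}[Num.sqrt n%:R]mul1r ler_pM2r // => b1'.
  by rewrite (_ : b = 1); [ring | lra].
by move: nE; set r := Num.sqrt _ => ->; ring.
Qed.

Lemma Delta_trunc : (Delta (2 * b - b ^+ 2) <= (pi * b ^+ 2 + 2 / n%:R)%:E)%E.
Proof.
have /andP[b0 b1] := b01; have n0' : 0 < n%:R :> R by rewrite ltr0n.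
pose d j := trunc_prim j.+1 - trunc_prim j.
(* Shifting by one cell gives a bound with [sqrt (i + 1)], the form required by [beta_sum]. Dropping
   the first cell loses mean at most [1 / n], which costs [2 / n] in the result. *)
pose a i := if (i.+1 < n)%N then d i.+1 else 0.
have a01 i : 0 <= a i <= 1.
  rewrite /a; case: ifP => _; last by rewrite lexx ler01.
  by have [? ? _] := trunc_primS i.+1; apply/andP.
have aB i : a i <= b * Num.sqrt n%:R * (Num.sqrt i.+1%:R)^-1.
  have s0 : 0 < Num.sqrt i.+1%:R :> R by rewrite sqrtr_gt0.
  rewrite ler_pdivlMr // /a; case: ifP => _.
    by have [] := trunc_primS i.+1.
  by rewrite mul0r mulr_ge0 ?sqrtr_ge0.
have rE : Num.sqrt n%:R * Num.sqrt n%:R = n%:R :> R by rewrite -expr2 sqr_sqrtr.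
have HM k : \sum_(u < k.+1) a u * a (k - u)%N <= n%:R * (pi * b ^+ 2).
  apply: (@le_trans _ _ (\sum_(u < k.+1) (b ^+ 2 * n%:R) *
      ((Num.sqrt u.+1%:R)^-1 * (Num.sqrt (k - u).+1%:R)^-1))).
    apply: ler_sum => u _.
    apply: (@le_trans _ _ ((b * Num.sqrt n%:R * (Num.sqrt u.+1%:R)^-1) *
      (b * Num.sqrt n%:R * (Num.sqrt (k - u).+1%:R)^-1))).
      by apply: ler_pM => //; [case/andP: (a01 u) | case/andP: (a01 (k - u)%N)].
    by rewrite -[X in b ^+ 2 * X]rE; lra.
  rewrite -mulr_sumr [n%:R * _]mulrA [n%:R * pi]mulrC -[leRHS]mulrA mulrC.
  by rewrite [n%:R * _]mulrC ler_wpM2r ?beta_sum // mulr_ge0 ?sqr_ge0.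
have sa : \sum_(i < n) a i = trunc_prim n - trunc_prim 1.
  rewrite /a -(big_mkord xpredT (fun i => if (i.+1 < n)%N then d i.+1 else 0)).
  case: n n0 => // m _; rewrite big_nat_recr //= ltnn addr0.
  rewrite (eq_big_nat _ _ (F2 := fun i => trunc_prim i.+2 - trunc_prim i.+1)).
    by rewrite (telescope_sumr (fun i => trunc_prim i.+1)).
  by move=> i /andP[_ im]; rewrite ltnS im.
have avg : (\sum_(i < n) a i) / n%:R = 2 * b - b ^+ 2 - trunc_prim 1 / n%:R.
  by rewrite sa trunc_primn; field; rewrite gt_eqF.
have /andP[p0 p1] := trunc_prim1.
have q0 : 0 <= trunc_prim 1 / n%:R by rewrite divr_ge0.
have q1 : trunc_prim 1 / n%:R <= n%:R^-1 by rewrite ler_pdivrMr // mulVf ?gt_eqF.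
apply: le_trans (Delta_step n0 a01 HM _) _.
  by rewrite avg; apply/andP; split; nra.
by rewrite avg lee_fin; lra.
Qed.

End truncated_sqrt.

(** With [s = sqrt (1 - eps)] and [b = 1 - s], [eps = (1 - s) * (1 + s) = 2 b - b ^ 2], so the bound
    is [pi * b ^ 2], reached by letting [n] grow in [Delta_trunc]. *)
Lemma Delta_pi (eps : R) : 0 < eps <= 1 ->
  (Delta eps <= (pi * eps ^+ 2 / (1 + Num.sqrt (1 - eps)) ^+ 2)%:E)%E.
Proof.
case/andP => e0 e1; set s := Num.sqrt (1 - eps).
have s0 : 0 <= s by rewrite sqrtr_ge0.
have s2 : s ^+ 2 = 1 - eps by rewrite sqr_sqrtr // subr_ge0.
have s1 : s <= 1 by nra.
have eE : eps = 2 * (1 - s) - (1 - s) ^+ 2 by lra.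
have -> : pi * eps ^+ 2 / (1 + s) ^+ 2 = pi * (1 - s) ^+ 2.
  have -> : eps = (1 - s) * (1 + s) by lra.
  by field; rewrite gt_eqF // ltr_pwDl.
apply/lee_addgt0Pr => e e0'; rewrite {1}eE.
have [m me] : exists m : nat, m.+1%:R^-1 <= e / 2.
  exists (Num.trunc (2 / e)).
  rewrite -[leRHS]invrK lef_pV2 ?posrE ?invr_gt0 ?divr_gt0 // invf_div.
  suff /andP[_ /ltW] : (Num.trunc (2 / e))%:R <= 2 / e < (Num.trunc (2 / e)).+1%:R by [].
  by apply: truncn_itv; rewrite divr_ge0 // ltW.
apply: (le_trans (@Delta_trunc m.+1 (1 - s) _ _)) => //; first by apply/andP; split; lra.
by rewrite -EFinD lee_fin lerD2l mulrC -ler_pdivlMr.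
Qed.

(** With [s = sqrt (1 - eps)], [1 / (1 + s) ^ 2 - 1 / 4 = (1 - s) (3 + s) / (4 (1 + s) ^ 2)], and
    [1 - s <= eps]. *)
Lemma pi_expansion (eps : R) : 0 < eps < 1 ->
  `| pi * eps ^+ 2 / (1 + Num.sqrt (1 - eps)) ^+ 2 - pi / 4 * eps ^+ 2 |
     <= pi * eps ^+ 3.
Proof.
case/andP => e0 e1; set s := Num.sqrt (1 - eps).
have s0 : 0 <= s by rewrite sqrtr_ge0.
have s2 : s ^+ 2 = 1 - eps by rewrite sqr_sqrtr // subr_ge0 ltW.
have s1 : s <= 1 by nra.
have p0 : 0 <= pi :> R by exact: pi_ge0.
have q0 : 0 < (1 + s) ^+ 2 by rewrite exprn_gt0 // ltr_pwDl.
have -> : pi * eps ^+ 2 / (1 + s) ^+ 2 - pi / 4 * eps ^+ 2 =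
   pi * eps ^+ 2 * ((1 - s) * (3 + s) / 4 / (1 + s) ^+ 2).
  by field; rewrite gt_eqF // ltr_pwDl.
have -> : pi * eps ^+ 3 = pi * eps ^+ 2 * eps by rewrite -mulrA -exprSr.
have r0 : 0 <= (1 - s) * (3 + s) / 4 / (1 + s) ^+ 2.
  by rewrite divr_ge0 ?(ltW q0) // divr_ge0 // mulr_ge0; lra.
have pe0 : 0 <= pi * eps ^+ 2 by rewrite mulr_ge0 ?sqr_ge0.
rewrite (ger0_norm (mulr_ge0 pe0 r0)); apply: ler_wpM2l => //.
by rewrite ler_pdivrMr //; nra.
Qed.

End explicit_densities.

(** * Lower bounds *)

Section convolution.
Variables (R : comRingType) (G : finZmodType).
Implicit Types f g : G -> R.

Definition conv f g (c : G) : R := \sum_x f x * g (c - x).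
Definition corr f g (u : G) : R := \sum_x f x * g (x + u).

Lemma sum_conv f g : \sum_c conv f g c = (\sum_x f x) * \sum_x g x.
Proof.
rewrite exchange_big mulr_suml; apply: eq_bigr => x _.
rewrite -mulr_sumr; congr (_ * _).
by rewrite [RHS](reindex_inj (addIr (- x))).
Qed.

Lemma sum_corr f g : \sum_u corr f g u = (\sum_x f x) * \sum_x g x.
Proof.
rewrite exchange_big mulr_suml; apply: eq_bigr => x _.
by rewrite -mulr_sumr; congr (_ * _); rewrite [RHS](reindex_inj (addrI x)).
Qed.

(* For [f' = f] and [g' = g = f] this says that convolution and autocorrelation of [f]
   have the same sum of squares. *)
Lemma conv_pairing f g f' g' :
  \sum_z conv f g z * conv f' g' z = \sum_u corr g g' u * corr f' f u.
Proof.
transitivity (\sum_x \sum_y f x * f' y * corr g g' (x - y)).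
  rewrite (eq_bigr (fun z => \sum_x \sum_y f x * f' y * (g (z - x) * g' (z - y)))); last first.
    move=> z _; rewrite mulr_suml; apply: eq_bigr => x _.
    by rewrite mulr_sumr; apply: eq_bigr => y _; rewrite mulrACA.
  rewrite exchange_big; apply: eq_bigr => x _; rewrite exchange_big; apply: eq_bigr => y _.
  rewrite -mulr_sumr; congr (_ * _); rewrite (reindex_inj (addIr x)) /=.
  by apply: eq_bigr => z _; rewrite addrK addrA.
rewrite exchange_big.
rewrite [RHS](eq_bigr (fun u => \sum_y f' y * f (y + u) * corr g g' u)); last first.
  by move=> u _; rewrite mulrC mulr_suml.
rewrite [RHS]exchange_big; apply: eq_bigr => y _.
rewrite (reindex_inj (addrI y)); apply: eq_bigr => u _.
by rewrite addrAC subrr add0r [f' y * _]mulrC.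
Qed.

(** This turns the cross term in the square of the symmetrised function into values of the
    autoconvolution. *)
Lemma corr_refl f a u : corr (fun x => f (a - x)) f u = conv f f (a + u).
Proof.
rewrite /conv (reindex_inj (addIr u)); apply: eq_bigr => x _.
by rewrite mulrC; congr (_ * f _); rewrite opprD addrACA subrr addr0.
Qed.

Lemma corr_refl2 f a u : corr (fun x => f (a - x)) (fun x => f (a - x)) u = corr f f u.
Proof.
rewrite /corr (reindex_inj (inv_inj (subKr (a - u)))); apply: eq_bigr => x _ /=.
have -> : a - (a - u - x + u) = x by rewrite addrAC subrK subKr.
by rewrite -[a - u - x]addrA -opprD subKr addrC mulrC.
Qed.

End convolution.

(** * Autocorrelation of a window *)

Section interval_energy.
Local Open Scope nat_scope.

Lemma sum_truncated_squares N W : W <= N ->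
  6 * \sum_(u < N) (W - u) ^ 2 = W * W.+1 * (2 * W).+1.
Proof.
elim: N W => [|N IH] W; first by rewrite leqn0 => /eqP ->; rewrite big_ord0.
case: W => [_|W]; first by rewrite big1 // => i _; rewrite sub0n.
rewrite ltnS big_ord_recl /= mulnDr => WN.
have -> : \sum_(i < N) (W.+1 - bump 0 i) ^ 2 = \sum_(i < N) (W - i) ^ 2.
  by apply: eq_bigr => i _; rewrite /bump /= add1n subSS.
by rewrite IH // subn0; ring.
Qed.

(** The two summands count the overlap of the window with its cyclic translate without and with
    wrap-around. *)
Lemma interval_corr_le N W u : u < N -> W <= N ->
  \sum_(z < N) ((z < W) && ((z + u) %% N < W) : nat) <= (W - u) + (W - (N - u)).
Proof.
move=> uN WN.
have cnt lo hi : hi <= N -> \sum_(z < N) (lo <= z < hi : nat) = hi - lo.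
  move=> hN; have := @sum_interval (fun z => lo <= z < hi) xpredT lo hi N hN.
  rewrite sum1_card card_ord => <- //.
  by apply: eq_bigr => z _; rewrite andbT.
apply: (@leq_trans (\sum_(z < N) ((z < W - u : nat) + (N - u <= z < W : nat)))).
  apply: leq_sum => z _; case: (ltnP z W) => //= zW.
  have [zu|zu] := ltnP (z + u) N.
    rewrite modn_small //; case: ltnP => //= h.
    have -> : z < W - u by clear -h; lia.
    by rewrite leq_addr.
  have -> : N - u <= z by clear -zu; lia.
  by rewrite andTb; case: (_ < W); rewrite // addn1.
rewrite big_split /=; apply: leq_add.
  rewrite -[leqRHS]subn0 -(cnt 0) ?leq_subLR ?(leq_trans WN) ?leq_addl //.
by rewrite cnt.
Qed.

End interval_energy.

(** * Lower bound for the number of representations *)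

Section autocorrelation_bound.
Variable R : realFieldType.

Section cyclic.
Variables (n W N' : nat) (E : pred nat) (B : R).
Hypotheses (nN : (2 * n)%N = N'.+1) (Wn : (W <= n)%N).
Hypotheses (En : forall i, E i -> (i < n)%N) (HB : forall k, (reps E k)%:R <= B).

Let G := 'I_N'.+1.
Let f (x : G) : R := (E x)%:R.
Let h (x : G) : R := (x < W)%N%:R.
Let S : R := \sum_(x < n) (E x)%:R.

Let n_leN : (n <= N'.+1)%N.
Proof. by rewrite -nN leq_pmull. Qed.

Let W_leN : (W <= N'.+1)%N.
Proof. exact: leq_trans Wn n_leN. Qed.

Let n0 : (0 < n)%N.
Proof. by case: n nN. Qed.

Let valD (x y : G) : val (x + y) = ((x + y) %% N'.+1)%N.
Proof. by []. Qed.

Let sum_f : \sum_x f x = S.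
Proof.
rewrite /S [RHS](big_ord_widen N'.+1 (fun x => (E x)%:R)) // [RHS]big_mkcond.
apply: eq_bigr => x _; rewrite /f; case: ifP => // /negP xn.
by case: (boolP (E x)) => // /En.
Qed.

Let sum_h : \sum_x h x = W%:R.
Proof. by rewrite -natr_sum sum_lt_const. Qed.

(** In the cyclic group of order [2 n], two elements below [n] add up without wrap-around, so cyclic
    representations are genuine ones. *)
Let conv_le c : conv f f c <= B.
Proof.
apply: le_trans (HB c); rewrite /reps natr_sum.
rewrite (big_ord_widen N'.+1 (fun i => (E i && E (c - i)%N)%:R)) ?ltn_ord //.
rewrite [leRHS]big_mkcond; apply: ler_sum => x _.
rewrite /f -natrM mulnb; case: (boolP (E x)) => [Ex|_]; last by rewrite !andFb; case: ifP.
rewrite !andTb.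
case: (boolP (E _)) => [Ecx|_]; last by case: ifP.
have xn := En Ex; have := valD (c - x) x; rewrite subrK.
move: Ecx (En Ecx); set y := nat_of_ord (c - x)%R => Ey yn.
rewrite modn_small; last first.
  move: (nat_of_ord x) xn yn nN; clear.
  lia.
move=> /= cE; have -> : (x < c.+1)%N by rewrite cE ltnS leq_addl.
by rewrite cE addnK Ey.
Qed.

Let H := corr h h.
Let X : R := \sum_u H u * corr f f u.
(** The reflection [x -> n - 1 - x] preserves the first [n] points, so that [f'] is supported there
    like [f]. *)
Let a : G := inord n.-1.
Let f' (x : G) : R := f (a - x).

Let H_ge0 u : 0 <= H u.
Proof. by apply: sumr_ge0 => x _; rewrite mulr_ge0. Qed.

Let sum_H : \sum_u H u = W%:R ^+ 2.
Proof. by rewrite sum_corr sum_h. Qed.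

Let f'_supp (x : G) : f' x != 0 -> (x < n)%N.
Proof.
rewrite /f' /f; case: (boolP (E _)) => [Ea _|]; last by rewrite eqxx.
have := valD (a - x) x; rewrite subrK [val a]inordK; last by clear -nN; lia.
move: (En Ea); set y := nat_of_ord (a - x)%R => yn /esym.
have xN : (x < N'.+1)%N by [].
have [yx|yx] := ltnP (y + x) N'.+1.
  by rewrite modn_small // => yxE; clear -yxE n0; lia.
have -> : (y + x)%N = (N'.+1 + (y + x - N'.+1))%N by rewrite subnKC.
rewrite modnDl modn_small; last by clear -yn xN n_leN; lia.
by clear -yn xN n_leN yx n0; lia.
Qed.

Let conv_h_supp (g : G -> R) : (forall x : G, g x != 0 -> (x < n)%N) ->
  forall z : G, (n + W <= z)%N -> conv g h z = 0.
Proof.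
move=> Hg z zn; apply: big1 => x _; apply/eqP; rewrite mulf_eq0.
case: eqP => [//|/eqP /Hg xn]; rewrite orFb /h.
have := valD (z - x) x; rewrite subrK; set y := nat_of_ord (z - x)%R.
case: (ltnP y W) => [yW zE|_ _]; last by rewrite eqxx.
have : (z <= y + x)%N by rewrite [nat_of_ord z]zE leq_mod.
by move: (nat_of_ord x) (nat_of_ord z) yW xn zn; clear; lia.
Qed.

(* Cauchy-Schwarz for the convolution of [f + f'] with the window [h]: it is supported on
   [n + W] points. *)
Lemma smoothing_bound : 2 * S ^+ 2 * W%:R ^+ 2 <= (n + W)%:R * (X + B * W%:R ^+ 2).
Proof.
pose g z := conv f h z + conv f' h z.
have sum_f' : \sum_x f' x = S.
  by rewrite -sum_f [RHS](reindex_inj (inv_inj (subKr a))).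
have sum_g : \sum_z g z = 2 * (S * W%:R).
  by rewrite big_split /= !sum_conv sum_f' sum_f sum_h; ring.
have f_supp (x : G) : f x != 0 -> (x < n)%N.
  by rewrite /f; case: (boolP (E x)) => [/En //|]; rewrite eqxx.
have sum_g2 : \sum_z g z ^+ 2 <= 2 * X + 2 * (B * W%:R ^+ 2).
  rewrite (eq_bigr (fun z => conv f h z * conv f h z + conv f' h z * conv f' h z
     + 2 * (conv f h z * conv f' h z))); last by move=> z _; rewrite /g; ring.
  rewrite !big_split /= -mulr_sumr !conv_pairing.
  rewrite [\sum_u corr h h u * corr f' f' u](_ : _ = X); last first.
    by apply: eq_bigr => u _; rewrite corr_refl2.
  have : \sum_u corr h h u * corr f' f u <= B * W%:R ^+ 2.
    rewrite -sum_H mulr_sumr; apply: ler_sum => u _.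
    by rewrite mulrC corr_refl ler_wpM2r // conv_le.
  by rewrite -/X; lra.
have nW0 : 0 < (n + W)%:R :> R by rewrite ltr0n addn_gt0 n0.
pose d (z : G) : R := (z < n + W)%N%:R.
have gd z : g z = g z * d z.
  rewrite /d; case: ltnP => [_|zn]; first by rewrite mulr1.
  by rewrite /g !conv_h_supp // addr0 mul0r.
have sum_d : \sum_z d z = (n + W)%:R.
  by rewrite -natr_sum sum_lt_const // -nN mul2n -addnn leq_add2l.
(* [t] is the mean of [g] over the [n + W] points; Cauchy-Schwarz becomes nonnegativity of a sum of
   squares. *)
pose t := 2 * (S * W%:R) / (n + W)%:R.
have : 0 <= \sum_z (g z - t * d z) ^+ 2 by apply: sumr_ge0 => z _; exact: sqr_ge0.
rewrite (eq_bigr (fun z => g z ^+ 2 - 2 * t * g z + t ^+ 2 * d z)); last first.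
  move=> z _; rewrite sqrrB [X in _ = _ - 2 * t * X + _]gd.
  by rewrite exprMn /d; case: ltnP => _ /=; ring.
rewrite !big_split /= sumrN -!mulr_sumr sum_g sum_d.
have tE : t * (n + W)%:R = 2 * (S * W%:R) by rewrite /t divfK // gt_eqF.
have t2E : t ^+ 2 * (n + W)%:R = t * (2 * (S * W%:R)) by rewrite expr2 -mulrA tE.
rewrite t2E => H0.
have H1 : t * (2 * (S * W%:R)) <= 2 * X + 2 * (B * W%:R ^+ 2) by lra.
have H2 := ler_wpM2l (ltW nW0) H1.
have E2 : (n + W)%:R * (t * (2 * (S * W%:R))) = (2 * (S * W%:R)) ^+ 2.
  by rewrite mulrA [(n + W)%:R * t]mulrC tE expr2.
by rewrite E2 in H2; lra.
Qed.

(* The square sum over [u] of [al * (q u - mean q) - (H u - mean H)] is nonnegative. *)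
Lemma variance_bound (al : R) :
  2 * al * (X - S ^+ 2 * W%:R ^+ 2 / (2 * n)%:R) <=
  al ^+ 2 * (B * S ^+ 2 - S ^+ 4 / (2 * n)%:R)
  + ((2 * W%:R ^+ 3 + W%:R) / 3 - W%:R ^+ 4 / (2 * n)%:R).
Proof.
have N0 : (2 * n)%:R != 0 :> R by rewrite nN pnatr_eq0.
pose q := corr f f.
have sum_q : \sum_u q u = S ^+ 2 by rewrite sum_corr sum_f.
have sum_q2 : \sum_u q u ^+ 2 <= B * S ^+ 2.
  rewrite (eq_bigr (fun u => corr f f u * corr f f u)) // -conv_pairing.
  rewrite -sum_f expr2 -sum_conv mulr_sumr; apply: ler_sum => c _.
  by rewrite ler_wpM2r ?conv_le // sumr_ge0 // => x _; rewrite mulr_ge0.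
have sum_H2 : \sum_u H u ^+ 2 <= (2 * W%:R ^+ 3 + W%:R) / 3.
  apply: (@le_trans _ _ (\sum_(u : G) ((W - u) ^ 2 + (W - (N'.+1 - u)) ^ 2)%N%:R)).
    apply: ler_sum => u _.
    apply: (@le_trans _ _ (((W - u) + (W - (N'.+1 - u)))%N%:R ^+ 2)); last first.
      (* Since [W <= n], at most one of the two truncated differences is nonzero, and the square of
         the sum is the sum of the squares. *)
      rewrite -natrX ler_nat; case: (posnP (W - u)) => [->|Wu]; first by rewrite exp0n.
      have -> : (W - (N'.+1 - u) = 0)%N by move: nN Wn Wu; clear; lia.
      by rewrite exp0n // !addn0.
    rewrite ler_pXn2r ?nnegrE ?H_ge0 //.
    have := interval_corr_le (ltn_ord u) W_leN; rewrite -(ler_nat R) natr_sum.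
    apply: le_trans; apply: ler_sum => z _.
    by rewrite /h -natrM mulnb.
  rewrite -natr_sum big_split /=.
  have E1 := sum_truncated_squares W_leN.
  have E2 : (6 * \sum_(u < N'.+1) (W - (N'.+1 - u)) ^ 2 = W.-1 * W * (2 * W.-1).+1)%N.
    rewrite (reindex_inj rev_ord_inj) /=.
    case: W W_leN => [|W1] W1N; first by rewrite big1 // => i _; rewrite sub0n.
    rewrite (eq_bigr (fun u : 'I_N'.+1 => (W1 - u) ^ 2)%N); last first.
      by move=> u _; rewrite /= (subKn (ltn_ord u)) subSS.
    by rewrite sum_truncated_squares // ltnW.
  rewrite ler_pdivlMr // -natrM.
  have -> : 2 * W%:R ^+ 3 + W%:R = (2 * W ^ 3 + W)%N%:R :> R by rewrite natrD natrM natrX.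
  rewrite ler_nat; move: E1 E2; set s1 := (\sum_(_ < _) _)%N; set s2 := (\sum_(_ < _) _)%N.
  by case: W => [|W1] /=; nia.
pose ka := (al * S ^+ 2 - W%:R ^+ 2) / (2 * n)%:R.
have : 0 <= \sum_u (al * q u - H u - ka) ^+ 2 by apply: sumr_ge0 => u _; exact: sqr_ge0.
rewrite (eq_bigr (fun u => al ^+ 2 * q u ^+ 2 - 2 * al * (H u * q u) + H u ^+ 2
   - 2 * ka * (al * q u - H u) + ka ^+ 2)); last by move=> u _; ring.
have kaE : \sum_(u : G) ka ^+ 2 = ka * (al * S ^+ 2 - W%:R ^+ 2).
  by rewrite sumr_const card_ord -nN -[LHS]mulr_natr expr2 -mulrA /ka divfK.
rewrite !big_split /= !sumrN kaE -!mulr_sumr -/X.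
rewrite big_split /= sumrN -mulr_sumr sum_q sum_H => H0.
have H1 : al ^+ 2 * \sum_u q u ^+ 2 <= al ^+ 2 * (B * S ^+ 2).
  by rewrite ler_wpM2l ?sqr_ge0.
have kaE2 : ka * (al * S ^+ 2 - W%:R ^+ 2) = al ^+ 2 * S ^+ 4 / (2 * n)%:R
   - 2 * al * (S ^+ 2 * W%:R ^+ 2 / (2 * n)%:R) + W%:R ^+ 4 / (2 * n)%:R.
  by rewrite /ka; move: ((2 * n)%:R : R) N0 => NN NN0; field.
have H2 : 0 <= al ^+ 2 * (B * S ^+ 2) - 2 * al * X + (2 * W%:R ^+ 3 + W%:R) / 3
    - ka * (al * S ^+ 2 - W%:R ^+ 2) by lra.
rewrite kaE2 in H2; lra.
Qed.

End cyclic.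

(* The window [W = n / 4] and the weight [4 T ^ 2 / S ^ 2] nearly maximise the constant
   that the two preceding bounds yield together. *)
Lemma reps_lower_bound (T : nat) (E : pred nat) (B : R) : (25 <= T)%N ->
  (forall i, E i -> (i < 4 * T)%N) -> (forall k, (reps E k)%:R <= B) ->
  1219 / 2000 * (\sum_(x < 4 * T) (E x)%:R) ^+ 2 <= (4 * T)%:R * B.
Proof.
move=> T25 En HB; set S := \sum_(_ < _) _.
have B0 : 0 <= B by apply: le_trans (HB 0%N).
have [S0|S0] := eqVneq S 0.
  by rewrite S0 expr0n /= mulr0 mulr_ge0.
have nN : (2 * (4 * T))%N = (2 * (4 * T)).-1.+1.
  by rewrite prednK // !muln_gt0 /=; apply: leq_trans T25.
have Wn : (T <= 4 * T)%N by rewrite leq_pmull.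
have := smoothing_bound nN Wn En HB.
have := variance_bound nN Wn En HB (4 * T%:R ^+ 2 / S ^+ 2).
rewrite -/S; set X := \sum_(_ : _) _; rewrite !natrM natrD !natrM.
have : 25 <= T%:R :> R by rewrite ler_nat.
clearbody S X; move: (T%:R : R) => {T nN Wn En HB T25} T T25.
have T0' : 0 < T by apply: lt_le_trans T25.
have T0 : T != 0 by rewrite gt_eqF.
have S2 : 0 < S ^+ 2 by rewrite exprn_even_gt0.
(* Scaling by powers of [T] leaves linear inequalities in [s], [b], [x], up to a term in
   [T ^- 2]. *)
pose s := S ^+ 2 / T ^+ 2; pose b := B / T; pose x := X / T ^+ 3.
have s0 : 0 < s by rewrite divr_gt0 // exprn_gt0.
have sE : S ^+ 2 = s * T ^+ 2 by rewrite /s divfK // expf_neq0.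
have bE : B = b * T by rewrite /b divfK.
have xE : X = x * T ^+ 3 by rewrite /x divfK // expf_neq0.
have -> : S ^+ 4 = (S ^+ 2) ^+ 2 by rewrite -exprM.
rewrite sE bE xE; clearbody s b x => Hv Ha.
have Ta : 2 * s <= 5 * (x + b).
  by rewrite -(ler_pM2r (exprn_gt0 4 T0')); lra.
have Tv : 8 * (x - s / 8) <= 16 * (b - s / 8) + s * ((2 + T ^- 2) / 3 - 1 / 8).
  have Ts0 : 0 < T ^+ 3 / s by rewrite divr_gt0 // exprn_gt0.
  have s0' : s != 0 by rewrite gt_eqF.
  rewrite -(ler_pM2l Ts0); move: Hv; congr (_ <= _); field; exact/andP.
have Ts : s * T ^- 2 <= s * 25 ^- 2.
  rewrite (ler_pM2l s0) lef_pV2 ?posrE ?exprn_gt0 //.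
  by rewrite ler_pXn2r ?nnegrE // ltW.
(* Eliminating [x] gives [4 b >= (439 / 720 - 1 / (18 T ^ 2)) s], and [T >= 25] leaves at least
   [1219 / 2000]. *)
have : 1219 / 2000 * s <= 4 * b by lra.
by rewrite -(ler_pM2r (exprn_gt0 2 T0')); lra.
Qed.

End autocorrelation_bound.

(** * From integer sets back to measurable sets *)

Section lower_bound.
Import numFieldNormedType.Exports.
Variable R : realType.
Implicit Types A : set R.

(** Enclose [A] in an open [U] of measure at most [eps + eta]. The grid cells inside [U] increase
    under dyadic refinement to a set containing [A], so some level has nearly full measure, and its
    excess over [A] lies in [U] minus [A]. *)
Lemma cell_approximation A (eps eta : R) : Lmeasurable A -> A `<=` `[0, 1[%classic ->
  lambda A = eps%:E -> 0 < eta ->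
  exists (T : nat) (E : pred nat), [/\ (25 <= T)%N, forall i, E i -> (i < 4 * T)%N,
    eps - eta <= (\sum_(i < 4 * T) (E i)%:R) / (4 * T)%:R &
    (lambda (cells (4 * T) (fun i => (E i)%:R) (4 * T) `\` A) <= eta%:E)%E].
Proof.
move=> mA A01 lA eta0.
have [U [oU AU lU]] := outer_measure_open_le A eta0.
(* The factors 4 and 25 give the shape [4 * T] with [25 <= T] required by [reps_lower_bound]. *)
pose Q k := (4 * (25 * 2 ^ k))%N.
have Q0 k : (0 < Q k)%N by rewrite /Q !muln_gt0 expn_gt0.
have Q0' k : 0 < (Q k)%:R :> R by rewrite ltr0n.
pose cell k i : set R := `[i%:R / (Q k)%:R, (i%:R + 1) / (Q k)%:R[%classic.
have cellP k i x : cell k i x <-> i%:R <= x * (Q k)%:R < i%:R + 1.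
  by rewrite /cell /= in_itv /= ler_pdivrMr // ltr_pdivlMr.
pose E k i := (i < Q k)%N && `[< cell k i `<=` U >].
pose V k := \bigcup_(i in [set j | E k j]) cell k i.
have mV k : measurable (V k) by apply: bigcup_measurable => i _; exact: measurable_itv.
have VS k : V k `<=` V k.+1.
  move=> x [i /= /andP[iQ /asboolP iU] xi].
  have QS : (Q k.+1)%:R = 2 * (Q k)%:R :> R.
    by rewrite -natrM /Q expnS; congr (_%:R); ring.
  have QSn : Q k.+1 = (2 * Q k)%N by rewrite /Q expnS; ring.
  have /cellP /andP[x1 x2] := xi.
  have [j [ji jx]] : exists j, (j <= (2 * i).+1)%N /\ 
      (cell k.+1 j x /\ cell k.+1 j `<=` cell k i).
    have [h|h] := leP (2 * i%:R + 1) (x * (Q k.+1)%:R).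
      exists (2 * i).+1; split => //; split.
        by apply/cellP; rewrite -natr1 natrM; move: h; rewrite QS; lra.
      by move=> y /cellP; rewrite QS -natr1 natrM => hy; apply/cellP; lra.
    exists (2 * i)%N; split => //; split.
      by apply/cellP; rewrite natrM; move: h; rewrite QS; lra.
    by move=> y /cellP; rewrite QS natrM => hy; apply/cellP; lra.
  exists j; last by case: jx.
  rewrite /= /E; apply/andP; split.
    by rewrite QSn; clear -ji iQ; lia.
  by apply/asboolP; apply: subset_trans iU; case: jx.
have AV : A `<=` \bigcup_k V k.
  move=> x Ax; have := A01 _ Ax; rewrite /= in_itv /= => /andP[x0 x1].
  have /nbhs_ballP[r /= r0 rU] : nbhs x U by apply: open_nbhs_nbhs; split => //; exact: AU.
  have [k kr] : exists k, (Q k)%:R^-1 < r.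
    exists (Num.trunc r^-1).
    rewrite -[ltRHS]invrK ltf_pV2 ?posrE ?invr_gt0 //.
    set k := Num.trunc _.
    have /andP[_ /lt_le_trans] : k%:R <= r^-1 < k.+1%:R.
      by apply: truncn_itv; rewrite invr_ge0 ltW.
    apply; rewrite ler_nat /Q mulnA; apply: (leq_trans (ltn_expl k (isT : (1 < 2)%N))).
    by rewrite leq_pmull.
  have xQ0 : 0 <= x * (Q k)%:R by rewrite mulr_ge0.
  have [i xi] : exists i : nat, i%:R <= x * (Q k)%:R < i.+1%:R.
    by exists (Num.trunc (x * (Q k)%:R)); exact: truncn_itv.
  have ci : cell k i x by apply/cellP; rewrite natr1.
  exists k => //; exists i => //=; rewrite /E; apply/andP; split.
    rewrite -(ltr_nat R); case/andP: xi => /le_lt_trans + _; apply.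
    by rewrite -[ltRHS]mul1r ltr_pM2r.
  apply/asboolP => y yi; apply: rU; rewrite /ball /=.
  apply: lt_trans kr; rewrite -[ltRHS]mul1r ltr_pdivlMr //.
  rewrite -[X in _ * X](gtr0_norm (Q0' k)) -normrM ltr_norml mulrBl.
  move/cellP: yi; move/cellP: ci => /andP[? ?] /andP[? ?].
  by apply/andP; split; lra.
have lU' : (lambda U <= (eps + eta)%:E)%E.
  by rewrite EFinD -lA.
have [k lV] : exists k, ((eps - eta)%:E <= lambda (V k))%E.
  apply: contrapT => /forallNP H.
  have ndV : nondecreasing_seq V.
    by apply/nondecreasing_seqP => i; apply/subsetPset; exact: VS.
  have mU : measurable (\bigcup_k V k) by apply: bigcup_measurable.
  have {}cv := @nondecreasing_cvg_mu _ _ _ (@lebesgue_measure R) V mV mU ndV.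
  have : (limn (lebesgue_measure \o V) <= (eps - eta)%:E)%E.
    apply: lime_le; first by apply/cvg_ex; exists (lebesgue_measure (\bigcup_k V k)).
    apply: nearW => i /=; rewrite -lambda_lebesgue ltW // ltNge; apply/negP; exact: H.
  rewrite (cvg_lim _ cv) // => h.
  have := le_trans (le_lambda AV) h; rewrite lA lee_fin; lra.
exists (25 * 2 ^ k)%N, (E k); split.
- by rewrite leq_pmulr // expn_gt0.
- by move=> i /andP[].
- rewrite -lee_fin; apply: (le_trans lV); rewrite -/(Q k) mulr_suml.
  pose X i := if E k i then cell k i else set0.
  apply: (@le_trans _ _ (lambda (\bigcup_(i in [set j | (j < Q k)%N]) X i))).
    apply: le_lambda => x [i /= Ei xi]; exists i; first by case/andP: Ei.
    by rewrite /X Ei.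
  apply: (@lambda_bigcup_le R (Q k) X (fun i => (E k i)%:R / (Q k)%:R)) => i _.
  rewrite /X; case: (E k i); last by rewrite lambda0 mul0r.
  rewrite [X in (X <= _)%E]lambda_itv; last by rewrite ler_pM2r ?invr_gt0 // lerDl.
  by rewrite lee_fin mul1r; lra.
- rewrite -/(Q k); apply: (@le_trans _ _ (lambda (U `\` A))).
    apply: le_lambda => x [xE nAx]; split => //.
    have [i iQ xi] := mem_cells (Q0 k) xE.
    move: xi; case Ei : (E k i) => /= xi; last by clear -xi; lra.
    case/andP: Ei => _ /asboolP; apply; apply/cellP; rewrite mulrC; clear -xi; lra.
  have UA : lambda U = (eps%:E + lambda (U `\` A))%E.
    by rewrite (lambda_split U mA) setIidr // lA.
  by move: lU'; rewrite UA EFinD leeD2lE.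
Qed.

(** Reflection by [(m + 1) / Q] carries cell [i] onto cell [m - i], so each representation of [m]
    contributes a whole cell. *)
Lemma lambda_cells_refl_ge (Q : nat) (E : pred nat) (m : nat) : (0 < Q)%N ->
  (forall i, E i -> (i < Q)%N) ->
  (((reps E m)%:R / Q%:R)%:E <= lambda (cells Q (fun i => (E i)%:R) Q
     `&` refl (m.+1%:R / Q%:R) (cells Q (fun i => (E i)%:R) Q)) :> \bar R)%E.
Proof.
move=> Q0 EQ; pose P i := E i && E (m - i)%N.
have -> : ((reps E m)%:R / Q%:R)%:E = lambda (cells Q (fun i => (P i)%:R : R) m.+1).
  rewrite lambda_cells //; first by rewrite /reps natr_sum.
  by move=> i; case: (P i); rewrite /= ?lexx ?ler01.
apply: le_lambda => x xP; have Q0' : 0 < Q%:R :> R by rewrite ltr0n.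
have [i im] := mem_cells Q0 xP; case PE : (P i) => /= xi; last by clear -xi; lra.
case/andP: PE => Ei Emi.
split; first by exists i; rewrite /= ?EQ // in_itv /= Ei ltr_pdivrMr // ltr_pdivlMr // mulrC.
exists (m - i)%N; first exact: EQ.
rewrite /= in_itv /= Emi ltr_pdivrMr // ltr_pdivlMr // mulrBl divfK ?gt_eqF //.
by rewrite natrB // -natr1 /=; clear -xi; lra.
Qed.

Lemma Dsym_lower_bound A (eps : R) : Lmeasurable A -> A `<=` `[0, 1[%classic ->
  lambda A = eps%:E -> 0 < eps <= 1 ->
  ((1219 / 2000 * eps ^+ 2)%:E <= Dsym A)%E.
Proof.
move=> mA A01 lA /andP[e0 e1].
have D0 : (0 <= Dsym A)%E := le_trans (lambda_ge0 _) (lambda_refl_Dsym 0 mA).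
case DE : (Dsym A) D0 => [d| |] // _; last by rewrite leey.
rewrite lee_fin; apply/ler_addgt0Pr => e he.
(* [eta <= eps] allows squaring [eps - eta]; as [eps <= 1], the total loss is below
   [4 * eta <= e]. *)
pose eta := Num.min (e / 4) eps.
have eta0 : 0 < eta by rewrite lt_min divr_gt0.
have [eta1 eta2] : eta <= e / 4 /\ eta <= eps by split; rewrite ge_min lexx ?orbT.
have [T [E [T25 EQ ES lE]]] := cell_approximation mA A01 lA eta0.
set Q := (4 * T)%N in EQ ES lE; set Ec := cells _ _ _ in lE.
have Q0 : (0 < Q)%N by rewrite muln_gt0 /=; apply: leq_trans T25.
have Q0' : 0 < Q%:R :> R by rewrite ltr0n.
have HB m : (reps E m)%:R <= Q%:R * (d + 2 * eta).
  rewrite mulrC -ler_pdivrMr // -lee_fin.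
  apply: (le_trans (lambda_cells_refl_ge m Q0 EQ)); set c := _ / _.
  apply: (@le_trans _ _ (lambda ((A `&` refl c A) `|` ((Ec `\` A) `|` refl c (Ec `\` A))))).
    apply: le_lambda => x [xE cE].
    have [Ax|nAx] := pselect (A x); last by right; left.
    have [cA|ncA] := pselect (A (c - x)); last by right; right.
    by left.
  apply: (le_trans (lambdaU _ _)); rewrite EFinD; apply: leeD.
    by rewrite -DE; exact: lambda_refl_Dsym.
  apply: (le_trans (lambdaU _ _)); rewrite lambda_refl.
  apply: (le_trans (leeD lE lE)); rewrite -EFinD lee_fin; lra.
have := reps_lower_bound T25 EQ HB; rewrite -/Q; set S := \sum_(_ < _) _ in ES *.
move=> HS; have S1 : 1219 / 2000 * (S / Q%:R) ^+ 2 <= d + 2 * eta.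
  rewrite expr_div_n mulrA ler_pdivrMr ?exprn_gt0 //.
  by lra.
set r := S / Q%:R in ES S1.
have : (eps - eta) ^+ 2 <= r ^+ 2 by rewrite ler_pXn2r ?nnegrE //; lra.
by nra.
Qed.

Lemma Delta_lower_bound (eps : R) : 0 < eps <= 1 ->
  ((1219 / 2000 * eps ^+ 2)%:E <= Delta eps)%E.
Proof. by move=> eps01; apply: Delta_ge => A mA A01 lA; exact: Dsym_lower_bound lA _. Qed.

Lemma Delta_ge_linear (eps : R) : ((2 * eps - 1)%:E <= Delta eps)%E.
Proof.
apply: Delta_ge => A mA A01 lA.
apply: le_trans (lambda_refl_Dsym 1 mA).
have mB := Lmeasurable_refl 1 mA; set B := refl 1 A in mB *.
(* The reflection of [[0, 1[] is []0, 1]], so the union lies in the closed unit interval. *)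
have : (lambda (A `|` B) <= 1%:E)%E.
  rewrite -[1]subr0 -(@lambda_itv R 0 1 true false) //; apply: le_lambda => x [/A01|/A01];
    rewrite /= !in_itv /= => /andP[? ?]; apply/andP; split; lra.
rewrite (lambda_split (A `|` B) mA) setUK setDUl setDv set0U lA.
have : lambda B = (lambda (A `&` B) + lambda (B `\` A))%E.
  by rewrite (lambda_split B mA) setIC.
rewrite lambda_refl lA.
have := lambda_ge0 (A `&` B); have := lambda_ge0 (B `\` A).
case: (lambda (A `&` B)) => [u| |] //; case: (lambda (B `\` A)) => [v| |] //=.
by rewrite -!EFinD !lee_fin => v0 u0 [E1] E2; lra.
Qed.

End lower_bound.

(** * Assembly of the five estimates *)

Unset Implicit Arguments.

Theorem theorem1p2 (R : realType) :
  (* (i) *)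
  (forall eps : R, 11 / 16 <= eps <= 1 -> Delta eps = (2 * eps - 1)%:E) /\
  (forall eps : R, 1 / 2 <= eps <= 11 / 16 -> ((2 * eps - 1)%:E <= Delta eps)%E) /\
  (* (ii) *)
  (forall eps : R, 0 < eps <= 1 ->
     (((591 * 10 ^+ 3 + 389) / 10 ^+ 6 * eps ^+ 2)%:E <= Delta eps)%E) /\
  (* (iii) *)
  (forall eps : R, 0 < eps <= 1 ->
     (((5 * 10 ^+ 3 + 546) / 10 ^+ 4 * eps ^+ 2 + (88 * 10 ^+ 3 + 79) / 10 ^+ 6 * eps ^+ 3)%:E <= Delta eps)%E) /\
  (* (iv) *)
  (forall eps : R, 0 < eps <= 11 / 16 ->
     (Delta eps <= (96 / 121 * eps ^+ 2)%:E)%E) /\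
  (96 / 121 : R) < (79 * 10 ^+ 3 + 339) / 10 ^+ 5 /\
  (* (v) *)
  (forall eps : R, 0 < eps <= 1 ->
     (Delta eps <= (pi * eps ^+ 2 / (1 + Num.sqrt (1 - eps)) ^+ 2)%:E)%E) /\
  (* ... = (pi/4) eps^2 + O(eps^3) as eps -> 0+ *)
  (exists K : R, exists k : R, 0 < k /\
     forall eps : R, 0 < eps < k ->
       `| pi * eps ^+ 2 / (1 + Num.sqrt (1 - eps)) ^+ 2 - pi / 4 * eps ^+ 2 |
         <= K * eps ^+ 3).
Proof.
have lin (eps : R) := Delta_ge_linear eps.
have quad (eps : R) : 0 < eps <= 1 -> _ := @Delta_lower_bound R eps.
have c2 : (5 * 10 ^+ 3 + 546) / 10 ^+ 4 <= 555 / 1000 :> R by lra.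
have c3 : (88 * 10 ^+ 3 + 79) / 10 ^+ 6 <= 881 / 10000 :> R by lra.
split; [|split; [|split; [|split; [|split; [|split; [|split]]]]]].
- move=> eps /andP[e1 e2]; apply/le_anti/andP; split; last exact: lin.
  have := @Delta_step8 R 1 eps; rewrite mulr1 expr1n mulr1 => /(_ _ _)/le_trans; apply.
  + by rewrite ler01 lexx.
  + by rewrite e1.
  + by rewrite lee_fin; lra.
- by move=> eps _; exact: lin.
- move=> eps he; apply: le_trans (quad _ he); rewrite lee_fin ler_wpM2r ?sqr_ge0 //; lra.
- move=> eps he; have /andP[e0 e1] := he.
  have e2 : 0 <= eps ^+ 2 by exact: sqr_ge0.
  have e3 : 0 <= eps ^+ 3 by rewrite exprn_ge0 // ltW.
  have := ler_wpM2r e2 c2; have := ler_wpM2r e3 c3.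
  set u := _ / _ * eps ^+ 2; set v := _ / _ * eps ^+ 3 => hv hu.
  (* Up to 0.618 the quadratic bound suffices, as [0.555 + 0.0881 * 0.618 < 0.6095]; beyond, the
     linear one does. *)
  have [h|h] := leP eps (618 / 1000).
    apply: le_trans (quad _ he); rewrite lee_fin.
    have : eps ^+ 3 <= 618 / 1000 * eps ^+ 2 by rewrite exprS ler_wpM2r.
    by lra.
  apply: le_trans (lin eps); rewrite lee_fin.
  (* On [0.618, 1] the square lies below its chord; multiplying by [eps] bounds the cube as well and
     leaves a linear inequality. *)
  have k2 : eps ^+ 2 <= 1618 / 1000 * eps - 618 / 1000 by nra.
  have := ler_wpM2l (ltW e0) k2; rewrite -exprS => k3.
  by lra.
- move=> eps /andP[e0 e1].
  have := @Delta_step8 R (16 / 11 * eps) eps => /(_ _ _)/le_trans; apply.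
  + by apply/andP; split; lra.
  + by apply/andP; split; lra.
  + by rewrite lee_fin; lra.
- lra.
- by move=> eps; exact: Delta_pi.
- by exists pi, 1; split => // eps; exact: pi_expansion.
Qed.
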